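(* Let $K$ be an algebraically closed field. Let $L$ be a lattice (a free abelian group of finite rank) and let $G$ be a finite group acting on $L$ by automorphisms. If the invariant ring $K[L]^G$ is isomorphic (as a $K$-algebra) to a mixed Laurent polynomial ring, then $G$ is generated by reflections (on $L$).
   Context: $K[L]$ denotes the group ring of $L$ over $K$, on which $G$ acts by the $K$-algebra automorphisms induced by its action on $L$, and $K[L]^G$ is the subalgebra of $G$-fixed elements. If $L$ has rank $n$, then $K[L]\cong K[x_1^{\pm1},\ldots,x_n^{\pm1}]$. That $K[L]^G$ is isomorphic to a mixed Laurent polynomial ring means that there is an integer $k\in\{0,\ldots,n\}$ with $K[L]^G\cong K[x_1^{\pm1},\ldots,x_k^{\pm1},x_{k+1},\ldots,x_n]$. An element $\sigma\in G$ is called a $k$-reflection on $L$ if the sublattice $\{\sigma l - l\mid l\in L\}$ of $L$ has rank at most $k$; a reflection is a $1$-reflection. *)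

(* Defs.v *)
From HB Require Import structures.
From mathcomp Require Import all_boot all_order all_fingroup all_algebra.
From mathcomp Require Import finmap.
From mathcomp Require Import monalg.

Set Implicit Arguments.
Unset Strict Implicit.
Unset Printing Implicit Defensive.

Import GRing.Theory.

Local Open Scope fset_scope.
Local Open Scope ring_scope.

(* Monoid algebra K[M] of a commutative monoid M written additively: the      *)
(* finitely supported functions M -> K with the convolution product, << l >>  *)
(* being the basis element of l : M. The ring structure of monalg.v cannot be *)
(* used, since a monomType has no unit other than 1, which excludes groups.   *)
Definition monoid_algebra (K : comNzRingType) (M : nmodType) := {malg K[M]}.

Section MonoidAlgebra.
Variables (K : comNzRingType) (M : nmodType).
Local Notation KM := (monoid_algebra K M).

HB.instance Definition _ := GRing.Lmodule.copy KM {malg K[M]}.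

Implicit Types (f g h : KM) (k l : M) (c : K).

Definition ma_one : KM := << 0 >>.

Definition ma_mul f g : KM :=
  \sum_(k <- msupp f) \sum_(l <- msupp g) << f@_k * g@_l *g k + l >>.

Lemma ma_mulw (d1 d2 : {fset M}) f g : msupp f `<=` d1 -> msupp g `<=` d2 ->
  ma_mul f g = \sum_(k <- d1) \sum_(l <- d2) << f@_k * g@_l *g k + l >>.
Proof.
move=> le_d1 le_d2; rewrite /ma_mul (big_fset_incl _ le_d1) /=.
  apply/eq_bigr=> k _; apply/big_fset_incl => // l _ /mcoeff_outdom ->.
  by rewrite mulr0 monalgU0.
move=> k _ /mcoeff_outdom fk.
by rewrite big1 => // l _; rewrite fk mul0r monalgU0.
Qed.

Lemma ma_mulC : commutative ma_mul.
Proof.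
move=> f g; rewrite /ma_mul exchange_big /=; apply: eq_bigr => k _.
by apply: eq_bigr => l _; rewrite mulrC addrC.
Qed.

Lemma ma_mulDl : left_distributive ma_mul +%R.
Proof.
move=> f g h; have le2 := fsubset_refl (msupp h).
rewrite (ma_mulw (msuppD_le f g) le2) (ma_mulw (fsubsetUl _ (msupp g)) le2).
rewrite (ma_mulw (fsubsetUr (msupp f) _) le2) -big_split /=.
apply/eq_bigr=> k _; rewrite -big_split /=; apply/eq_bigr=> l _.
by rewrite mcoeffD mulrDl monalgUD.
Qed.

Lemma ma_mul0 : left_zero 0 ma_mul.
Proof. by move=> f; rewrite /ma_mul msupp0 big_seq_fset0. Qed.

Lemma ma_mulDr : right_distributive ma_mul +%R.
Proof. by move=> f g h; rewrite !(ma_mulC f) ma_mulDl. Qed.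

Lemma ma_mulr0 : right_zero 0 ma_mul.
Proof. by move=> f; rewrite ma_mulC ma_mul0. Qed.

Lemma ma_mulUU c1 c2 k l :
  ma_mul << c1 *g k >> << c2 *g l >> = << c1 * c2 *g k + l >>.
Proof. by rewrite (ma_mulw msuppU_le msuppU_le) !big_seq_fset1 !mcoeffUU. Qed.

Lemma ma_mul_suml (s : seq M) (F : M -> KM) g :
  ma_mul (\sum_(i <- s) F i) g = \sum_(i <- s) ma_mul (F i) g.
Proof.
exact: (big_morph (ma_mul^~ g) (fun _ _ => ma_mulDl _ _ _) (ma_mul0 _)).
Qed.

Lemma ma_mul_sumr (s : seq M) (F : M -> KM) g :
  ma_mul g (\sum_(i <- s) F i) = \sum_(i <- s) ma_mul g (F i).
Proof.
exact: (big_morph (ma_mul g) (fun _ _ => ma_mulDr _ _ _) (ma_mulr0 _)).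
Qed.

Lemma ma_mul1 : left_id ma_one ma_mul.
Proof.
move=> f; rewrite [f in LHS]monalgE ma_mul_sumr [RHS]monalgE.
by apply: eq_bigr => k _; rewrite ma_mulUU mul1r add0r.
Qed.

Lemma ma_mulA : associative ma_mul.
Proof.
move=> f g h; rewrite (monalgE f) (monalgE g) (monalgE h).
rewrite !(ma_mul_suml (msupp f)); apply: eq_bigr => i _.
rewrite (ma_mul_suml (msupp g)) !(ma_mul_sumr (msupp g)).
rewrite (ma_mul_suml (msupp g)); apply: eq_bigr => j _.
rewrite !(ma_mul_sumr (msupp h)); apply: eq_bigr => k _.
by rewrite !ma_mulUU mulrA addrA.
Qed.

Lemma ma_one_neq0 : ma_one != 0.
Proof. by rewrite monalgU_eq0 oner_eq0. Qed.

HB.instance Definition _ := GRing.Zmodule_isComNzRing.Build KM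
  ma_mulA ma_mulC ma_mul1 ma_mulDl ma_one_neq0.

Lemma ma_scaleU c c' k : c *: (<< c' *g k >> : KM) = << c * c' *g k >>.
Proof. by apply/malgP => l; rewrite mcoeffZ !mcoeffU mulrnAr. Qed.

Lemma ma_scaleAl c f g : c *: (f * g) = c *: f * g.
Proof.
rewrite (monalgE f) (monalgE g) [in RHS]scaler_sumr !mulr_suml scaler_sumr.
apply: eq_bigr => k _; rewrite !mulr_sumr scaler_sumr; apply: eq_bigr => l _.
by rewrite !ma_scaleU [_ * _]ma_mulUU [RHS]ma_mulUU ma_scaleU mulrA.
Qed.

HB.instance Definition _ := GRing.Lmodule_isLalgebra.Build K KM ma_scaleAl.
HB.instance Definition _ := GRing.Lalgebra_isComAlgebra.Build K KM.

End MonoidAlgebra.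

(* The K-algebra morphism K[M] -> K[N] induced by a monoid morphism M -> N.   *)
Section MonoidAlgebraMap.
Variables (K : comNzRingType) (M N : nmodType) (u : {additive M -> N}).
Local Notation KM := (monoid_algebra K M).
Local Notation KN := (monoid_algebra K N).

Definition ma_map (f : KM) : KN :=
  \sum_(l <- msupp f) << f@_l *g u l >>.

Lemma ma_mapw (d : {fset M}) (f : KM) : msupp f `<=` d ->
  ma_map f = \sum_(l <- d) << f@_l *g u l >>.
Proof.
move=> le_d; apply: big_fset_incl => // l _ /mcoeff_outdom ->.
by rewrite monalgU0.
Qed.

Lemma ma_mapU c l : ma_map << c *g l >> = << c *g u l >>.
Proof. by rewrite (ma_mapw msuppU_le) big_seq_fset1 mcoeffUU. Qed.

Lemma ma_map_linear : linear ma_map.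
Proof.
move=> c f g; pose d := msupp f `|` msupp g.
have le_f : msupp f `<=` d by exact: fsubsetUl.
have le_g : msupp g `<=` d by exact: fsubsetUr.
have le_cfg : msupp (c *: f + g) `<=` d.
  by apply: fsubset_trans (msuppD_le _ _) (fsetSU _ (msuppZ_le _ _)).
rewrite (ma_mapw le_f) (ma_mapw le_g) (ma_mapw le_cfg) scaler_sumr -big_split.
by apply: eq_bigr => l _; rewrite mcoeffD mcoeffZ monalgUD ma_scaleU.
Qed.

HB.instance Definition _ := GRing.isLinear.Build K KM KN _ ma_map
  ma_map_linear.

Lemma ma_map_monoid_morphism : monoid_morphism ma_map.
Proof.
split=> [|f g]; first by rewrite ma_mapU raddf0.
rewrite (monalgE f) (monalgE g) mulr_suml !linear_sum mulr_suml.
apply: eq_bigr => k _; rewrite !mulr_sumr linear_sum; apply: eq_bigr => l _ /=.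
by rewrite [_ * _]ma_mulUU !ma_mapU [RHS]ma_mulUU raddfD.
Qed.

HB.instance Definition _ := GRing.isMonoidMorphism.Build KM KN ma_map
  ma_map_monoid_morphism.

End MonoidAlgebraMap.

(* K[x_1^+-1, ..., x_k^+-1, x_(k+1), ..., x_n] as the monoid algebra of its   *)
(* monoid of exponents Z^k * N^(n - k); only meaningful for k <= n.           *)
Definition mixed_laurent (K : comNzRingType) (n k : nat) :=
  monoid_algebra K ({ffun 'I_k -> int} * {ffun 'I_(n - k) -> nat})%type.

Section Rank.
Variable L : zmodType.

Definition int_comb n (b : 'I_n -> L) (c : {ffun 'I_n -> int}) : L :=
  \sum_i b i *~ c i.

Definition is_basis n (b : 'I_n -> L) (S : L -> Prop) :=
  injective (int_comb b) /\ (forall x, S x <-> exists c, x = int_comb b c).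

(* S is a subgroup of L that is free abelian of rank n.                       *)
Definition has_rank (S : L -> Prop) n := exists b : 'I_n -> L, is_basis b S.

End Rank.

Definition lattice_of_rank (L : zmodType) n := has_rank (fun _ : L => True) n.

(* Left actions of G on the abelian group L by automorphisms.                 *)
Record lattice_action (G : finGroupType) (L : zmodType) := LatticeAction {
  lact :> G -> L -> L;
  lact1 : forall x, lact 1%g x = x;
  lactM : forall g h x, lact (g * h)%g x = lact g (lact h x);
  lactD : forall g, {morph lact g : x y / x + y}
}.

Section Action.
Variables (G : finGroupType) (L : zmodType) (act : lattice_action G L).

Lemma lact_nmod_morphism g : nmod_morphism (act g).
Proof.
split; last exact: lactD.
by apply: (addrI (act g 0)); rewrite -lactD !addr0.
Qed.

HB.instance Definition _ g := GRing.isNmodMorphism.Build L L (act g)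
  (lact_nmod_morphism g).

Definition k_reflection k (g : G) :=
  exists2 r, (r <= k)%N & has_rank (fun x => exists l, x = act g l - l) r.

Definition reflection := k_reflection 1.

Variable K : comNzRingType.
Local Notation KL := (monoid_algebra K L).

Definition invariant : {pred KL} :=
  fun f => [forall g, ma_map (act g) f == f].

Lemma invariant_subalg_closed : subalg_closed invariant.
Proof.
split=> [|c f g|f g]; first by apply/forallP=> s; rewrite rmorph1.
  move=> /forallP Hf /forallP Hg; apply/forallP => s.
  by rewrite linearP /= (eqP (Hf s)) (eqP (Hg s)).
move=> /forallP Hf /forallP Hg; apply/forallP => s.
by rewrite rmorphM /= (eqP (Hf s)) (eqP (Hg s)).
Qed.

HB.instance Definition _ := GRing.isSubalgClosed.Build K KL invariant
  invariant_subalg_closed.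

Record invariant_ring := InvariantRing {
  invariant_val :> KL;
  _ : invariant_val \in invariant
}.

HB.instance Definition _ := [isSub for invariant_val].
HB.instance Definition _ := [Choice of invariant_ring by <:].
HB.instance Definition _ := [SubChoice_isSubComNzRing of invariant_ring by <:].
HB.instance Definition _ := [SubZmodule_isSubLmodule of invariant_ring by <:].
HB.instance Definition _ :=
  [SubNzRing_SubLmodule_isSubLalgebra of invariant_ring by <:].
HB.instance Definition _ := [SubLalgebra_isSubAlgebra of invariant_ring by <:].

End Action.

(* Main.v *)
From HB Require Import structures.
Require Import Defs.
From mathcomp Require Import all_boot all_order all_fingroup all_algebra.
From mathcomp Require Import finmap monalg ring zify.
From Stdlib Require Import Classical ClassicalEpsilon.

(* Write S = K[L], R = S^G, let H be the subgroup generated by the reflections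
   and A = S^H; it suffices to show that G fixes A. The Taylor expansion along a
   line in the coordinates of R is a ring morphism theta : R -> S[t]/t^(N+1).
   For b in A with distinct conjugates, Hensel's lemma extends theta to A after
   the substitution t -> delta_b^2 t, where delta_b is the product of the b - gb
   over the nontrivial g in G/H. Taking b = prod_(h in H) (c - hs) with c in K
   and interpolating at c = s, the denominators of the extension divide powers
   of prod_(g notin H) (s - gs), for every s in S. For s = x^l and s = x^l' with
   l, l' generic these two products form a regular sequence, because (g - 1)L
   has rank at least 2 for every g outside H. So theta extends to
   Phi : A -> S[t]/t^(N+1), and uniquely, whence Phi commutes with G. As the
   augmentation eps : S -> K is G-invariant, eps(Phi(ga - a)) = 0 for a in A, and
   eps(theta) kills the norm of ga - a, which lies in R. A nonzero norm would be
   detected by some line through the point of Spec R below the point 1. *)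

Set Implicit Arguments.
Unset Strict Implicit.
Unset Printing Implicit Defensive.

Import Order.TTheory GRing.Theory Num.Theory.
Local Open Scope ring_scope.

(** * Lifting along a nilpotent element *)

Definition regular (C : comNzRingType) (d : C) := forall x, d * x = 0 -> x = 0.

Lemma regular_inj (C : comNzRingType) (d : C) :
  regular d -> injective ( *%R d).
Proof.
move=> reg_d x y /eqP; rewrite -subr_eq0 -mulrBr => /eqP /reg_d /eqP.
by rewrite subr_eq0 => /eqP.
Qed.

Section Regular.
Variable S : comNzRingType.
Implicit Types U V : S.

Lemma regular1 : regular (1 : S).
Proof. by move=> x; rewrite mul1r. Qed.

Lemma regularM U V : regular U -> regular V -> regular (U * V).
Proof. by move=> regU regV x; rewrite -mulrA => /regU/regV. Qed.

Lemma regularN U : regular U -> regular (- U).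
Proof.
move=> regU x Ux; apply: regU; apply/eqP.
by rewrite -oppr_eq0 -mulNr Ux.
Qed.

Lemma regular_neq0 U : regular U -> U != 0.
Proof.
move=> regU; apply/eqP => U0; case/eqP: (oner_neq0 S).
by apply: regU; rewrite U0 mul0r.
Qed.

Lemma regular_bigprod I (r : seq I) (P : pred I) (F : I -> S) :
  (forall i, P i -> regular (F i)) -> regular (\prod_(i <- r | P i) F i).
Proof.
move=> regF; elim/big_ind: _ => //; first exact: regular1.
by move=> U1 U2; apply: regularM.
Qed.

Lemma regularX U m : regular U -> regular (U ^+ m).
Proof.
move=> regU; rewrite -(subn0 m) -prodr_const_nat.
exact: regular_bigprod.
Qed.

End Regular.

Section NilpotentLifting.
Variables (C : comNzRingType) (tau : C) (n : nat).
Hypothesis tau_nil : tau ^+ n = 0.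

Lemma unit_add_nilpotent x : exists u, (1 + tau * x) * u = 1.
Proof.
pose y := - (tau * x); exists (\sum_(i < n) y ^+ i).
have -> : 1 + tau * x = - (y - 1) by rewrite /y; ring.
by rewrite mulNr -subrX1 /y exprNn exprMn tau_nil mul0r mulr0 sub0r opprK.
Qed.

(** If [y] is killed by [d + tau * x], then [d * y] is a multiple of [tau]; iterating, [d ^+ n * y]
    is a multiple of [tau ^+ n], which is zero. *)
Lemma regular_add_nilpotent d x : regular d -> regular (d + tau * x).
Proof.
move=> reg_d y /eqP; rewrite mulrDl addr_eq0 => /eqP dy.
have step k : exists z, d ^+ k * y = tau ^+ k * z.
  elim: k => [|k [z IHk]]; first by exists y.
  exists (- (x * z)); rewrite exprSr -mulrA dy.
  by transitivity (- (tau * x) * (d ^+ k * y)); [|rewrite IHk exprS]; ring.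
have [z] := step n; rewrite tau_nil mul0r => dny.
elim: n dny => [|k IHk]; first by rewrite mul1r.
by rewrite exprS -mulrA => /reg_d.
Qed.

Lemma horner_taylor2 (p : {poly C}) x y :
  exists w, p.[x + y] = p.[x] + p^`().[x] * y + w * y ^+ 2.
Proof.
elim/poly_ind: p => [|p c [w IHp]].
  by exists 0; rewrite deriv0 !horner0; ring.
exists (p^`().[x] + w * x + w * y); rewrite derivD derivM derivX derivC.
by rewrite !(hornerD, hornerM, hornerX, hornerC) IHp; ring.
Qed.

Lemma horner_taylor1 (p : {poly C}) x y : exists w, p.[x + y] = p.[x] + w * y.
Proof.
by have [w ->] := horner_taylor2 p x y; exists (p^`().[x] + w * y); ring.
Qed.

(** The factor [delta ^+ 2] in [f.[b]] lets Newton's iteration run without inverting [delta]: every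
    correction is a multiple of [delta], so the quadratic error is again a multiple of [delta ^+ 2].
    Each step gains a factor [tau]. *)
Lemma nilpotent_hensel (f : {poly C}) b delta e e' :
    f.[b] = delta ^+ 2 * tau * e -> f^`().[b] = delta * (1 + tau * e') ->
  exists y, f.[b + delta * tau * y] = 0.
Proof.
move=> fb f'b; suff [y [z fy]] : exists y z,
    f.[b + delta * tau * y] = delta ^+ 2 * tau ^+ n.+1 * z.
  by exists y; rewrite fy [tau ^+ _]exprS tau_nil; ring.
elim: (n) => [|k [y [z fy]]]; first by exists 0, e; rewrite mulr0 addr0 fb.
set beta := b + _ in fy; have [w f'beta] : exists w,
    f^`().[beta] = delta * (1 + tau * w).
  have [w ->] := horner_taylor1 f^`() b (delta * tau * y).
  by exists (e' + w * y); rewrite f'b; ring.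
(* One Newton step at [beta], with [delta] in place of the derivative. *)
exists (y - tau ^+ k * z).
have [v fv] := horner_taylor2 f beta (- (delta * tau ^+ k.+1 * z)).
exists (- (w * z) + v * tau ^+ k * z ^+ 2).
have -> : b + delta * tau * (y - tau ^+ k * z) =
          beta + - (delta * tau ^+ k.+1 * z).
  by rewrite /beta exprS; ring.
by rewrite fv fy f'beta !exprS; ring.
Qed.

End NilpotentLifting.

(** * Extending a morphism from R to A when f'(b) A lies in R[b] *)

Section Extension.
Variables (R A C : comNzRingType) (iota : {rmorphism R -> A}).
Variables (f : {poly R}) (b : A).
Hypothesis fb : (map_poly iota f).[b] = 0.
Let d := (map_poly iota f)^`().[b].
Hypothesis gen_b : forall a, exists q, (map_poly iota q).[b] = d * a.

Variables (tau : C) (n : nat).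
Hypothesis tau_nil : tau ^+ n = 0.

(** Both morphisms send [b] to a root of the same polynomial. Two roots congruent modulo [tau]
    coincide when the derivative there is regular, and the value at [b] determines the morphism on
    [d * a] for every [a]. *)
Lemma extension_unique (chi1 chi2 : {rmorphism A -> C}) z :
    chi1 b = chi2 b + tau * z -> regular (chi2 d) ->
    (forall r, chi1 (iota r) = chi2 (iota r)) ->
  chi1 =1 chi2.
Proof.
move=> chib reg eqR.
have eqpoly p : map_poly chi1 (map_poly iota p) =
                map_poly chi2 (map_poly iota p).
  by apply/polyP=> i; rewrite !coef_map /= eqR.
have eqb : chi1 b = chi2 b.
  pose g := map_poly chi2 (map_poly iota f).
  have g1 : g.[chi1 b] = 0 by rewrite /g -eqpoly horner_map fb rmorph0.
  have g2 : g.[chi2 b] = 0 by rewrite /g horner_map fb rmorph0.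
  have g2' : g^`().[chi2 b] = chi2 d.
    by rewrite /g deriv_map horner_map.
  have [w] := horner_taylor2 g (chi2 b) (tau * z).
  rewrite -chib g1 g2 g2' add0r => eq0.
  rewrite chib; have -> : tau * z = 0; last by rewrite addr0.
  apply: (regular_add_nilpotent tau_nil (x := w * z) reg).
  by rewrite [RHS]eq0; ring.
have eqd : chi1 d = chi2 d.
  by rewrite /d -!horner_map -!deriv_map eqpoly eqb.
move=> a; apply: (regular_inj reg); have [q qb] := gen_b a.
by rewrite /= -{1}eqd -!rmorphM -qb -!horner_map eqpoly eqb.
Qed.

Variables (theta : {rmorphism R -> C}) (kappa : {rmorphism A -> C}).
Hypothesis reg_d : regular (kappa d).
Hypothesis theta_kappa :
  forall r, exists e, theta r = kappa (iota r) + kappa d ^+ 2 * tau * e.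
Hypothesis min_f :
  forall p, (map_poly iota p).[b] = 0 -> exists w, p = f * w.

Let delta := kappa d.

(* [Phi a] is [q(beta) / f'(beta)], where [q(b) = f'(b) a] and [beta] is the
   root of [theta f] near [kappa b]. *)
Lemma extension_exists : exists Phi : {rmorphism A -> C},
  (forall r, Phi (iota r) = theta r) /\
  (forall a, exists e, Phi a = kappa a + tau * e).
Proof.
have thetaP p : exists E, map_poly theta p =
    map_poly kappa (map_poly iota p) + (delta ^+ 2 * tau)%:P * E.
  elim/poly_ind: p => [|p c [E IHp]].
    by exists 0; rewrite !rmorph0 mulr0 addr0.
  have [e ec] := theta_kappa c; exists (E * 'X + e%:P).
  rewrite !(rmorphD, rmorphM) /= !map_polyX !map_polyC /= IHp ec.
  by rewrite !(rmorphD, rmorphM) /=; ring.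
have theta_at p y : exists w, (map_poly theta p).[kappa b + delta * tau * y] =
    kappa (map_poly iota p).[b] + delta * tau * w.
  have [E ->] := thetaP p; rewrite -horner_map.
  have [w wE] := horner_taylor1 (map_poly kappa (map_poly iota p)) (kappa b)
                   (delta * tau * y).
  exists (w * y + delta * E.[kappa b + delta * tau * y]).
  by rewrite hornerD hornerCM wE; ring.
pose g := map_poly theta f.
have [y gy] : exists y, g.[kappa b + delta * tau * y] = 0.
  have [E gE] := thetaP f.
  have [w gw] := theta_at f^`() 0.
  apply: (nilpotent_hensel tau_nil (e := E.[kappa b]) (e' := w)).
    by rewrite /g gE hornerD hornerCM horner_map fb rmorph0 add0r.
  move: gw; rewrite mulr0 addr0 -!deriv_map -/d -/delta -/g => ->; ring.
set beta := kappa b + _ in gy; have [w g'w] := theta_at f^`() y.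
have {}g'w : (map_poly theta f^`()).[beta] = delta * (1 + tau * w).
  by rewrite g'w -!deriv_map -/d -/delta; ring.
set g' := _.[beta] in g'w.
have reg_g' : regular g'.
  have [u uE] := unit_add_nilpotent tau_nil w.
  move=> x; rewrite g'w -mulrA => /reg_d eq0.
  by rewrite -[x]mul1r -uE -mulrA [u * _]mulrC mulrA eq0 mul0r.
(* By minimality of [f], the value of a polynomial over R at [beta] depends only on its value at
   [b]. *)
have vanish p : (map_poly iota p).[b] = 0 -> (map_poly theta p).[beta] = 0.
  by move=> /min_f[v ->]; rewrite rmorphM hornerM gy mul0r.
pose spec a x := forall q, (map_poly iota q).[b] = d * a ->
  g' * x = (map_poly theta q).[beta].
have sol a : {x | spec a x /\ exists e, x = kappa a + tau * e}.
  apply: constructive_indefinite_description.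
  have [q qb] := gen_b a; have [v] := theta_at q y; rewrite -/beta => qv.
  have [u uE] := unit_add_nilpotent tau_nil w.
  exists ((kappa a + tau * v) * u); split.
    move=> q' q'b; have := vanish (q - q').
    rewrite !rmorphB hornerD hornerN qb q'b subrr => /(_ erefl).
    rewrite hornerD hornerN => /eqP.
    rewrite subr_eq0 => /eqP <-; rewrite qv qb rmorphM g'w -/delta.
    transitivity (delta * (kappa a + tau * v) * ((1 + tau * w) * u)).
      by ring.
    by rewrite uE; ring.
  exists (v * u - kappa a * w * u).
  have {2}-> : kappa a = kappa a * ((1 + tau * w) * u) by rewrite uE mulr1.
  by ring.
pose Phi a := sval (sol a).
have PhiE a : spec a (Phi a) by rewrite /Phi; case: (sol a) => x [].
have uniq_x a x q : (map_poly iota q).[b] = d * a ->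
    g' * x = (map_poly theta q).[beta] -> Phi a = x.
  by move=> qb gx; apply: (regular_inj reg_g'); rewrite /= (PhiE a q qb).
have Phi_zmod : zmod_morphism Phi.
  move=> a1 a2; have [q1 qb1] := gen_b a1; have [q2 qb2] := gen_b a2.
  apply: (uniq_x _ _ (q1 - q2)); rewrite rmorphB hornerD hornerN.
    by rewrite qb1 qb2; ring.
  by rewrite mulrBr (PhiE _ _ qb1) (PhiE _ _ qb2).
have Phi_iota r : Phi (iota r) = theta r.
  apply: (uniq_x _ _ (r%:P * f^`())).
    by rewrite rmorphM /= map_polyC hornerCM -deriv_map mulrC.
  by rewrite rmorphM /= map_polyC hornerCM mulrC.
have Phi_monoid : monoid_morphism Phi.
  split=> [|a1 a2]; first by rewrite -[1](rmorph1 iota) Phi_iota rmorph1.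
  have [q1 qb1] := gen_b a1; have [q2 qb2] := gen_b a2.
  have [q qb] := gen_b (a1 * a2); apply: (uniq_x _ _ q qb).
  have := vanish (q1 * q2 - q * f^`()).
  rewrite !(rmorphB, rmorphM) /= !(hornerD, hornerN, hornerM).
  rewrite qb1 qb2 qb -!deriv_map -/d.
  have -> : d * a1 * (d * a2) - d * (a1 * a2) * d = 0 by ring.
  move=> /(_ erefl)/eqP; rewrite subr_eq0 deriv_map -/g' => /eqP eqM.
  apply: (regular_inj reg_g'); rewrite /= [RHS]mulrC -eqM.
  by rewrite -(PhiE _ _ qb1) -(PhiE _ _ qb2); ring.
pose PhiA := GRing.isZmodMorphism.Build A C Phi Phi_zmod.
pose PhiM := GRing.isMonoidMorphism.Build A C Phi Phi_monoid.
pose Phi1 : {additive A -> C} := HB.pack Phi PhiA.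
pose Phi2 : {rmorphism A -> C} := HB.pack Phi PhiA PhiM.
exists Phi2; split=> // a; rewrite /= /Phi; by case: (sol a) => x [].
Qed.

End Extension.

(** * Truncated power series *)

(** The quotient by [p] is really taken by [mk_monic p], which is [p] only for monic [p] of positive
    degree; the exponent [N.+1] guarantees this. *)
Definition jet (N : nat) (S : comNzRingType) :=
  {poly %/ ('X^(N.+1) : {poly S})}.
HB.instance Definition _ N S := GRing.ComNzRing.on (jet N S).

Section Jet.
Import Pdiv.CommonRing Pdiv.RingMonic.
Variables (N : nat) (S : comNzRingType).
Local Notation J := (jet N S).
Implicit Types (x y : J) (s : S) (p : {poly S}).

Definition to_jet : {poly S} -> J := in_qpoly _.
HB.instance Definition _ := GRing.RMorphism.on to_jet.

Definition jetC : S -> J := qpolyC _.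
HB.instance Definition _ := GRing.RMorphism.on jetC.

Definition jetX : J := to_jet 'X.

Definition jcoef k x : S := (x : {poly S})`_k.

Lemma mk_monic_jet : mk_monic ('X^(N.+1) : {poly S}) = 'X^(N.+1).
Proof. by rewrite mk_monic_Xn. Qed.

Lemma size_jet x : (size (x : {poly S}) <= N.+1)%N.
Proof.
have sz : size (mk_monic ('X^(N.+1) : {poly S})) = N.+2.
  by rewrite mk_monic_jet size_polyXn.
by rewrite -ltnS -[N.+2]sz size_mk_monic.
Qed.

Lemma jetP x y : (forall k, (k <= N)%N -> jcoef k x = jcoef k y) -> x = y.
Proof.
move=> eq_xy; apply/val_inj/polyP => k.
have [/eq_xy//|lt_Nk] := leqP k N.
by rewrite !nth_default // (leq_trans (size_jet _)).
Qed.

Lemma jcoefD k : {morph jcoef k : x y / x + y}.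
Proof. by move=> x y; rewrite /jcoef [val _]/= coefD. Qed.

Lemma to_jet_mod p : to_jet p = rmodp p 'X^(N.+1) :> {poly S}.
Proof.
by have -> : rmodp p 'X^(N.+1) = rmodp p (mk_monic 'X^(N.+1));
  rewrite ?mk_monic_jet.
Qed.

Lemma jcoef_to_jet k p : (k <= N)%N -> jcoef k (to_jet p) = p`_k.
Proof.
move=> le_kN; rewrite /jcoef to_jet_mod.
rewrite [p in RHS](rdivp_eq (monicXn _ N.+1)) coefD coefMXn ltnS le_kN.
by rewrite add0r.
Qed.

Lemma to_jetK x : to_jet x = x.
Proof. by apply: jetP => k le_kN; rewrite jcoef_to_jet. Qed.

Lemma to_jetC s : to_jet s%:P = jetC s.
Proof. by rewrite -[RHS]to_jetK. Qed.

Lemma jetX_nil : jetX ^+ N.+1 = 0.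
Proof.
rewrite -rmorphXn; apply: jetP => k le_kN; rewrite jcoef_to_jet //.
by rewrite coefXn ltn_eqF // /jcoef coef0.
Qed.

Lemma jcoefC k s : jcoef k (jetC s) = if k == 0 then s else 0.
Proof. by rewrite /jcoef coefC. Qed.

Lemma jcoef_sum k (c : nat -> S) : (k <= N)%N ->
  jcoef k (\sum_(i < N.+1) jetC (c i) * jetX ^+ i) = c k.
Proof.
move=> le_kN; under eq_bigr do rewrite -to_jetC -rmorphXn -rmorphM mul_polyC.
by rewrite -rmorph_sum -poly_def jcoef_to_jet // coef_poly ltnS le_kN.
Qed.

Lemma jet_sum x : x = \sum_(i < N.+1) jetC (jcoef i x) * jetX ^+ i.
Proof. by apply: jetP => k le_kN; rewrite jcoef_sum. Qed.

Lemma jcoefCM k s x : (k <= N)%N -> jcoef k (jetC s * x) = s * jcoef k x.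
Proof.
move=> le_kN; rewrite [x in LHS]jet_sum mulr_sumr.
under eq_bigr do rewrite mulrA -rmorphM.
by rewrite (jcoef_sum (fun i => s * jcoef i x)).
Qed.

Lemma jetC_regular s : regular s -> regular (jetC s).
Proof.
move=> reg_s x sx0; apply: jetP => k le_kN.
rewrite [RHS]coef0; apply: reg_s.
by rewrite -jcoefCM // sx0 /jcoef coef0.
Qed.

Lemma jet_split x : exists y, x = jetC (jcoef 0 x) + jetX * y.
Proof.
rewrite {1}[x]jet_sum big_ord_recl expr0 mulr1.
exists (\sum_(i < N) jetC (jcoef i.+1 x) * jetX ^+ i).
congr (_ + _); rewrite mulr_sumr; apply: eq_bigr => i _.
by rewrite exprS mulrCA.
Qed.

Section Eval.
Variables (E : comNzRingType) (h : {rmorphism S -> E}) (tau : E).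

(** Taking the proof of nilpotency as an argument lets the ring morphism structure be inferred from
    the term itself. *)
Definition jet_eval of tau ^+ N.+1 = 0 := fun x : J => (map_poly h x).[tau].

Hypothesis tau_nil : tau ^+ N.+1 = 0.
Local Notation ev := (jet_eval tau_nil).

Lemma jet_evalE x : ev x = \sum_(i < N.+1) h (jcoef i x) * tau ^+ i.
Proof.
rewrite /ev (horner_coef_wide _ (n := N.+1)).
  by apply: eq_bigr => i _; rewrite coef_map.
exact: leq_trans (size_poly _ _) (size_jet x).
Qed.

Lemma jet_eval_to_jet p : ev (to_jet p) = (map_poly h p).[tau].
Proof.
rewrite /ev to_jet_mod [p in RHS](rdivp_eq (monicXn _ N.+1)).
rewrite rmorphD rmorphM /= map_polyXn hornerD hornerM hornerXn tau_nil.
by rewrite mulr0 add0r.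
Qed.

Lemma jet_eval_zmod_morphism : zmod_morphism ev.
Proof. by move=> x y; rewrite /ev /= rmorphB hornerD hornerN. Qed.

Lemma jet_eval_monoid_morphism : monoid_morphism ev.
Proof.
split=> [|x y]; first by rewrite -[1](rmorph1 to_jet) jet_eval_to_jet
  rmorph1 hornerC.
rewrite -{1}[x]to_jetK -{1}[y]to_jetK -rmorphM jet_eval_to_jet.
by rewrite rmorphM hornerM.
Qed.

HB.instance Definition _ := GRing.isZmodMorphism.Build J E ev
  jet_eval_zmod_morphism.
HB.instance Definition _ := GRing.isMonoidMorphism.Build J E ev
  jet_eval_monoid_morphism.

Lemma jet_evalC s : ev (jetC s) = h s.
Proof. by rewrite -to_jetC jet_eval_to_jet map_polyC hornerC. Qed.

Lemma jet_evalX : ev jetX = tau.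
Proof. by rewrite jet_eval_to_jet map_polyX hornerX. Qed.

End Eval.
End Jet.

Arguments jetC N {S}.

Section JetMap.
Variables (N : nat) (S S' : comNzRingType) (h : {rmorphism S -> S'}).

Definition jet_map : jet N S -> jet N S' :=
  jet_eval (jetC N \o h) (jetX_nil N S').
HB.instance Definition _ := GRing.RMorphism.on jet_map.

Lemma jcoef_map k x : (k <= N)%N -> jcoef k (jet_map x) = h (jcoef k x).
Proof.
move=> le_kN; rewrite /jet_map jet_evalE.
by rewrite (jcoef_sum (fun i => h (jcoef i x))).
Qed.

Lemma jet_mapC s : jet_map (jetC N s) = jetC N (h s).
Proof. exact: jet_evalC. Qed.

Lemma jet_mapX : jet_map (jetX N S) = jetX N S'.
Proof. exact: jet_evalX. Qed.

End JetMap.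

Section JetScale.
Variables (N : nat) (S : comNzRingType) (d : S).

Lemma jet_scale_nil : (jetC N d * jetX N S) ^+ N.+1 = 0.
Proof. by rewrite exprMn jetX_nil mulr0. Qed.

Definition jet_scale : jet N S -> jet N S := jet_eval (jetC N) jet_scale_nil.
HB.instance Definition _ := GRing.RMorphism.on jet_scale.

Lemma jcoef_scale k x : (k <= N)%N ->
  jcoef k (jet_scale x) = d ^+ k * jcoef k x.
Proof.
move=> le_kN; rewrite /jet_scale jet_evalE.
under eq_bigr do rewrite exprMn mulrA -rmorphXn -rmorphM mulrC.
rewrite -(jcoef_sum (fun i => d ^+ i * jcoef i x) le_kN).
by congr jcoef; apply: eq_bigr => i _; rewrite [jcoef _ _ * _]mulrC mulrC.
Qed.

Lemma jet_scaleC s : jet_scale (jetC N s) = jetC N s.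
Proof. exact: jet_evalC. Qed.

Lemma jet_scaleX : jet_scale (jetX N S) = jetC N d * jetX N S.
Proof. exact: jet_evalX. Qed.

End JetScale.

(** * Generic points of a lattice *)

(** The vectors [d k] are nonzero polynomials evaluated at [M]; their product has finitely many
    roots, so some natural number avoids them all. Geometrically, the moment curve leaves any finite
    union of hyperplanes. *)
Lemma generic_moment (n : nat) (I : finType) (d : I -> 'I_n -> int) :
    (forall k, exists i, d k i != 0) ->
  exists M : nat, forall k, \sum_i d k i * M%:Z ^+ i != 0.
Proof.
move=> nz_d; pose p k : {poly int} := \sum_i (d k i)%:P * 'X^i.
have nz_p k : p k != 0.
  have [i nz_i] := nz_d k; apply: contraNneq nz_i => /(congr1 (coefp i)) /=.
  rewrite coef_sum (bigD1 i) //= coefCM coefXn eqxx mulr1 coef0.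
  rewrite big1 ?addr0 => [->//|j ne_ji].
  by rewrite coefCM coefXn eq_sym (inj_eq val_inj) (negPf ne_ji) mulr0.
pose P := \prod_k p k.
have nz_P : P != 0 by apply/prodf_neq0 => k _; exact: nz_p.
pose rs := [seq Posz i | i <- iota 0 (size P)].
have uniq_rs : uniq rs by rewrite map_inj_uniq ?iota_uniq // => i j [].
have : ~~ all (root P) rs.
  apply/negP => /(max_poly_roots nz_P)/(_ uniq_rs).
  by rewrite size_map size_iota ltnn.
rewrite -has_predC => /hasP[_ /mapP[M _ ->]] /= nrM.
exists M => k; apply: contraNneq nrM => pk0.
rewrite /root horner_prod (bigD1 k) //= mulf_eq0; apply/orP; left.
rewrite horner_sum -[X in _ == X]pk0; apply/eqP/eq_bigr => i _.
by rewrite hornerM hornerC hornerXn.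
Qed.

Section Lattice.
Variables (L : zmodType) (n : nat) (b : 'I_n -> L).
Hypothesis basis_b : is_basis b (fun _ => True).

Lemma int_combB m (v : 'I_m -> L) c c' :
  int_comb v (c - c') = int_comb v c - int_comb v c'.
Proof.
rewrite /int_comb -sumrB; apply: eq_bigr => i _.
by rewrite !ffunE mulrzBr.
Qed.

Fact coords_proof x : {c | x = int_comb b c}.
Proof.
apply: constructive_indefinite_description.
by have [_ /(_ x)[/(_ I)]] := basis_b.
Qed.

Definition coords x := sval (coords_proof x).

Lemma coordsK x : int_comb b (coords x) = x.
Proof. by rewrite /coords; case: coords_proof. Qed.

Definition coord i x := coords x i.

Lemma coord_zmod_morphism i : zmod_morphism (coord i).
Proof.
have [inj_b _] := basis_b.
move=> x y; rewrite /coord; have -> : coords (x - y) = coords x - coords y.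
  by apply: inj_b; rewrite int_combB !coordsK.
by rewrite !ffunE.
Qed.

HB.instance Definition _ i := GRing.isZmodMorphism.Build L int (coord i)
  (coord_zmod_morphism i).

Lemma coordMz i x c : coord i (x *~ c) = coord i x * c.
Proof. by rewrite raddfMz -mulrzr intz. Qed.

Lemma coord_eq0 x : (forall i, coord i x = 0) -> x = 0.
Proof.
move=> x0; rewrite -[x]coordsK /int_comb big1 // => i _.
by have := x0 i; rewrite /coord => ->.
Qed.

Lemma coord_neq0 x : x != 0 -> exists i, coord i x != 0.
Proof.
move=> nz_x; apply: NNPP => no_i; case/eqP: nz_x; apply: coord_eq0 => i.
by apply: NNPP => /eqP nz_i; apply: no_i; exists i.
Qed.

Lemma generic_form (D : seq L) : (forall x, x \in D -> x != 0) ->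
  exists lam : {additive L -> int}, forall x, x \in D -> lam x != 0.
Proof.
move=> nz_D; pose d (k : 'I_(size D)) i := coord i (tnth (in_tuple D) k).
have [k|M gM] := @generic_moment _ _ d.
  by apply/coord_neq0/nz_D/mem_tnth.
pose lam x := \sum_i coord i x * M%:Z ^+ i.
have lamB : zmod_morphism lam.
  move=> x y; rewrite /lam -sumrB; apply: eq_bigr => i _.
  by rewrite raddfB mulrBl.
pose lamA : {additive L -> int} :=
  HB.pack lam (GRing.isZmodMorphism.Build L int lam lamB).
exists lamA => x /(tnthP (in_tuple D))[k ->]; exact: gM.
Qed.

(** A nonzero form is nonzero on some basis vector, so [generic_moment] applies to the values of the
    forms on the basis. *)
Lemma generic_point (I : finType) (phi : I -> {additive L -> int}) :
    (forall k, exists x, phi k x != 0) ->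
  exists x, forall k, phi k x != 0.
Proof.
move=> nz_phi; have [k|M gM] := @generic_moment _ _ (fun k i => phi k (b i)).
  have [x nz_x] := nz_phi k; apply: NNPP => no_i; case/eqP: nz_x.
  rewrite -[x]coordsK /int_comb raddf_sum big1 // => i _.
  rewrite raddfMz; suff -> : phi k (b i) = 0 by rewrite mul0rz.
  by apply: NNPP => /eqP nz_i; apply: no_i; exists i.
exists (\sum_i b i *~ (M%:Z ^+ i)) => k; rewrite raddf_sum.
by under eq_bigr do rewrite raddfMz -mulrzr intz.
Qed.

(* If all [T x] are proportional to [m], a coordinate [p] with [m_p <> 0] embeds
   the image of [T] in [int], where it is generated by an element of minimal
   positive absolute value. *)
Lemma rank_le1 (T : {additive L -> L}) (m : L) : m != 0 ->
    (forall x p q, coord p m * coord q (T x) = coord q m * coord p (T x)) ->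
  exists2 r, (r <= 1)%N & has_rank (fun x => exists l, x = T l) r.
Proof.
move=> /coord_neq0[p nz_p] prop.
have T0 x : coord p (T x) = 0 -> T x = 0.
  move=> Tx0; apply: coord_eq0 => q; have /eqP := prop x p q.
  by rewrite Tx0 mulr0 mulf_eq0 (negPf nz_p) => /eqP.
have [all0|] := classic (forall x, coord p (T x) = 0).
  exists 0%N => //; exists (fun _ => 0); split=> [c c' _|x].
    by apply/ffunP; case.
  split=> [[l ->]|[c ->]].
    by exists 0; rewrite T0 // /int_comb big_ord0.
  by exists 0; rewrite raddf0 /int_comb big_ord0.
move=> /not_all_ex_not[x1 /eqP nz_x1].
pose P (k : nat) := exists2 x, coord p (T x) != 0 & `|coord p (T x)|%N = k.
pose Pb k := if excluded_middle_informative (P k) then true else false.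
have PbP k : reflect (P k) (Pb k).
  by rewrite /Pb; case: excluded_middle_informative => h; constructor.
have exP : exists k, Pb k by exists `|coord p (T x1)|%N; apply/PbP; exists x1.
have [k /PbP[x0 nz_x0 def_k] min_k] := ex_minnP exP.
pose a := coord p (T x0).
have gen x : exists c, T x = T x0 *~ c.
  (* The remainder of the division by [a] is again the coordinate of some value of [T], so
     minimality of [k] forces it to vanish. *)
  exists (coord p (T x) %/ a)%Z; apply/eqP; rewrite -subr_eq0 -raddfMz -raddfB.
  apply/eqP/T0; apply: contraTeq isT => nz_r.
  have /min_k : Pb `|(coord p (T x) %% a)%Z|%N.
    apply/PbP; exists (x - x0 *~ (coord p (T x) %/ a)%Z) => //.
    rewrite !raddfB /modz; congr (`|_ - _|%N).
    by rewrite [T (_ *~ _)]raddfMz [LHS]coordMz mulrC.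
  have := ltz_mod (coord p (T x)) nz_x0; have := modz_ge0 (coord p (T x)) nz_x0.
  by rewrite -def_k -/a; lia.
exists 1%N => //; exists (fun=> T x0); split=> [c c'|x].
  rewrite /int_comb !big_ord1 => /(congr1 (coord p)).
  rewrite !coordMz => /(mulfI nz_x0) eq_c.
  by apply/ffunP => i; rewrite ord1.
split=> [[l ->]|[c ->]].
  have [c ->] := gen l; exists [ffun=> c].
  by rewrite /int_comb big_ord1 ffunE.
by exists (x0 *~ c ord0); rewrite raddfMz /int_comb big_ord1.
Qed.

(** The 2 x 2 minors of the pair of vectors [m], [x]; they all vanish exactly when the two are
    linearly dependent. *)
Definition minor m p q (x : L) : int :=
  coord p m * coord q x - coord q m * coord p x.

Lemma minor_zmod_morphism m p q : zmod_morphism (minor m p q).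
Proof. by move=> x y; rewrite /minor !raddfB /=; ring. Qed.

HB.instance Definition _ m p q := GRing.isZmodMorphism.Build L int
  (minor m p q) (minor_zmod_morphism m p q).

(** First [l] is chosen generic, so that every [T i l] is nonzero. As the image of [T j] has rank at
    least 2, it is not proportional to [T i l], so some minor is a nonzero form on it; then [l'] is
    chosen generic for these finitely many forms. *)
Lemma generic_pair (I : finType) (T : I -> {additive L -> L}) :
    (forall k r, (r <= 1)%N -> ~ has_rank (fun x => exists l, x = T k l) r) ->
  exists l l', forall i j, [/\ T i l != 0, T j l' != 0 &
    exists2 lam : {additive L -> int}, lam (T j l') = 0 & lam (T i l) != 0].
Proof.
move=> big_rank.
have nzT k : exists p, exists x, coord p (T k x) != 0.
  apply: NNPP => no_p; apply: (big_rank k 0%N) => //.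
  have T0 x : T k x = 0.
    apply: coord_eq0 => p; apply: NNPP => /eqP nz; apply: no_p.
    by exists p, x.
  exists (fun=> 0); split=> [c c' _|x]; first by apply/ffunP; case.
  split=> [[l ->]|[c ->]]; first by exists 0; rewrite T0 // /int_comb big_ord0.
  by exists 0; rewrite raddf0 /int_comb big_ord0.
pose p0 k := sval (constructive_indefinite_description _ (nzT k)).
have [k|l gen_l] := @generic_point _ (fun k => coord (p0 k) \o T k).
  by rewrite /p0; case: constructive_indefinite_description.
have nz_l k : T k l != 0.
  by apply: contraNneq (gen_l k) => /= ->; rewrite raddf0.
have nz_minor (ij : I * I) : exists pq : 'I_n * 'I_n, exists x,
    minor (T ij.1 l) pq.1 pq.2 (T ij.2 x) != 0.
  apply: NNPP => no_pq.
  have [x p q|r le_r1 rank_r] := @rank_le1 (T ij.2) _ (nz_l ij.1).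
    apply: NNPP => /eqP; rewrite -subr_eq0 => nz; apply: no_pq.
    by exists (p, q), x.
  exact: (big_rank ij.2 r).
pose pq ij := sval (constructive_indefinite_description _ (nz_minor ij)).
have [ij|l' gen_l'] := @generic_point _
    (fun ij => minor (T ij.1 l) (pq ij).1 (pq ij).2 \o T ij.2).
  by rewrite /pq; case: constructive_indefinite_description.
exists l, l' => i j; split=> //.
  by apply: contraNneq (gen_l' (i, j)) => /= ->; rewrite raddf0.
(* The minor is alternating: it vanishes at [T j l'], and exchanging its two vectors only changes
   its sign. *)
exists (minor (T j l') (pq (i, j)).1 (pq (i, j)).2).
  by rewrite /= /minor; ring.
have := gen_l' (i, j); rewrite /= -oppr_eq0; congr (_ != 0).
by rewrite /minor; ring.
Qed.

End Lattice.

(** * Monoid algebras *)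

Section Monomials.
Variables (K : comNzRingType) (M : nmodType).
Local Notation KM := (monoid_algebra K M).
Implicit Types (f g : KM) (k l : M) (c : K).

Definition mono l : KM := << l >>.

Lemma mono0 : mono 0 = 1. Proof. by []. Qed.

Lemma monoD k l : mono (k + l) = mono k * mono l.
Proof. by rewrite [RHS]ma_mulUU mulr1. Qed.

Lemma mono_coef k l : (mono k)@_l = (k == l)%:R.
Proof. by rewrite mcoeffU. Qed.

Lemma ma_expand f : f = \sum_(l <- msupp f) f@_l *: mono l.
Proof.
rewrite [LHS]monalgE; apply: eq_bigr => l _.
by rewrite [RHS]ma_scaleU mulr1.
Qed.

End Monomials.

Section Lift.
Variables (K : comNzRingType) (M : nmodType) (E : comNzRingType).
Variables (c : {rmorphism K -> E}) (mu : M -> E).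
Local Notation KM := (monoid_algebra K M).

Definition ma_lift of mu 0 = 1 & {morph mu : x y / x + y >-> x * y} :=
  fun f : KM => \sum_(l <- msupp f) c f@_l * mu l.

Hypotheses (mu0 : mu 0 = 1) (muD : {morph mu : x y / x + y >-> x * y}).
Local Notation lift := (ma_lift mu0 muD).

Lemma ma_liftw (d : {fset M}) (f : KM) : (msupp f `<=` d)%fset ->
  lift f = \sum_(l <- d) c f@_l * mu l.
Proof.
move=> le_d; apply: big_fset_incl => // l _ /mcoeff_outdom ->.
by rewrite rmorph0 mul0r.
Qed.

Lemma ma_liftU a l : lift << a *g l >> = c a * mu l.
Proof. by rewrite (ma_liftw msuppU_le) big_seq_fset1 mcoeffUU. Qed.

Lemma ma_lift_mono l : lift (mono K l) = mu l.
Proof. by rewrite ma_liftU rmorph1 mul1r. Qed.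

Lemma ma_lift_zmod_morphism : zmod_morphism lift.
Proof.
move=> f g; pose d := (msupp f `|` msupp g)%fset.
rewrite (@ma_liftw d f) ?fsubsetUl // (@ma_liftw d g) ?fsubsetUr //.
rewrite (@ma_liftw d (f - g)) ?msuppB_le // -sumrB.
by apply: eq_bigr => l _; rewrite mcoeffB rmorphB mulrBl.
Qed.

HB.instance Definition _ := GRing.isZmodMorphism.Build KM E lift
  ma_lift_zmod_morphism.

Lemma ma_lift_monoid_morphism : monoid_morphism lift.
Proof.
split=> [|f g]; first by rewrite ma_liftU rmorph1 mul1r.
rewrite (monalgE f) (monalgE g) mulr_suml !raddf_sum mulr_suml.
apply: eq_bigr => k _; rewrite !mulr_sumr raddf_sum; apply: eq_bigr => l _ /=.
by rewrite [_ * _]ma_mulUU !ma_liftU rmorphM muD; ring.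
Qed.

HB.instance Definition _ := GRing.isMonoidMorphism.Build KM E lift
  ma_lift_monoid_morphism.

Lemma ma_liftZ a f : lift (a *: f) = c a * lift f.
Proof.
rewrite (@ma_liftw (msupp f) (a *: f)) ?msuppZ_le // mulr_sumr.
by apply: eq_bigr => l _; rewrite mcoeffZ rmorphM mulrA.
Qed.

End Lift.

Section GroupAlgebra.
Variables (K : comNzRingType) (L : zmodType).
Local Notation KL := (monoid_algebra K L).
Implicit Types (f g : KL) (k l : L).

Lemma mcoeff_monoM k (f : KL) l : (mono K k * f)@_l = f@_(l - k).
Proof.
rewrite [f in LHS](ma_expand f) mulr_sumr raddf_sum /=.
under eq_bigr do rewrite -scalerAr -monoD mcoeffZ mono_coef.
have [l_f|nl_f] := boolP (l - k \in msupp f); last first.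
  rewrite mcoeff_outdom // big_seq big1 // => i i_f.
  case: eqP => [def_l|_]; last by rewrite mulr0.
  by case/negP: nl_f; rewrite -def_l [k + i]addrC addrK.
rewrite (bigD1_seq (l - k)) ?fset_uniq //= [k + _]addrC subrK eqxx mulr1.
rewrite big1 ?addr0 // => i ne_i.
case: eqP => [def_l|_]; last by rewrite mulr0.
by case/eqP: ne_i; rewrite -def_l [k + i]addrC addrK.
Qed.

Lemma mcoeff_binomM c d (f : KL) l :
  ((mono K c - mono K d) * f)@_l = f@_(l - c) - f@_(l - d).
Proof. by rewrite mulrBl mcoeffB !mcoeff_monoM. Qed.

Lemma mcoeffM_sum (f g : KL) m :
  (f * g)@_m = \sum_(k <- msupp f) f@_k * g@_(m - k).
Proof.
rewrite [f in LHS](ma_expand f) mulr_suml raddf_sum /=; apply: eq_bigr => k _.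
by rewrite -scalerAl mcoeffZ mcoeff_monoM.
Qed.

Definition ma_restr (P : pred L) (f : KL) : KL :=
  [malg l in msupp f => if P l then f@_l else 0].

Lemma mcoeff_restr P f l : (ma_restr P f)@_l = if P l then f@_l else 0.
Proof.
rewrite mcoeffE; case: ifP => // /negbT /mcoeff_outdom ->.
by rewrite if_same.
Qed.

(* [lam] grades the algebra, [mono a - mono a'] being homogeneous and
   [mono c - mono d] not: the relation determines the truncation of [f] at
   [lam < i] modulo [mono a - mono a'] from its truncation at
   [lam < i - (lam c - lam d)]. *)
Lemma mono_dvd (lam : {additive L -> int}) (a a' c d : L) (f g : KL) :
    lam a = lam a' -> lam c != lam d ->
    (mono K c - mono K d) * f = (mono K a - mono K a') * g ->
  exists h, f = (mono K a - mono K a') * h.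
Proof.
move=> lam_a; wlog lt_dc : c d g / lam d < lam c => [IH|_].
  rewrite neq_lt => /orP[lt_cd|lt_dc] eq_fg; last first.
    by apply: (IH c d g) => //; rewrite gt_eqF.
  by apply: (IH d c (- g)); rewrite ?gt_eqF // mulrN -eq_fg; ring.
set V := _ - mono K a' => eq_fg.
have lamB x y : lam (x - y) = lam x - lam y by exact: raddfB.
pose F (i : int) := ma_restr (fun l => lam l < i) f.
have shift (i : int) : mono K d * F i = mono K c * F (i - (lam c - lam d)) -
    V * ma_restr (fun l => lam l < i + lam d - lam a) g.
  apply/malgP => l; have /malgP/(_ l) := eq_fg.
  rewrite mcoeffB /V !mcoeff_binomM !mcoeff_monoM !mcoeff_restr /= !lamB -lam_a.
  have -> : (lam l - lam d < i) = (lam l < i + lam d) by lia.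
  have -> : (lam l - lam c < i - (lam c - lam d)) = (lam l < i + lam d) by lia.
  have -> : (lam l - lam a < i + lam d - lam a) = (lam l < i + lam d) by lia.
  case: ifP => _; last by move=> _; ring.
  by move=> eq_l; rewrite -eq_l; ring.
pose N : nat := \sum_(l <- msupp f) `|lam l|%N.
have le_N l : l \in msupp f -> (`|lam l| <= N)%N.
  by move=> l_f; rewrite /N (big_rem l) //= leq_addr.
have F_small (i : int) : i <= - N%:Z -> F i = 0.
  move=> le_i; apply/malgP => l; rewrite mcoeff_restr mcoeff0.
  have [/le_N le_l|/mcoeff_outdom ->] := boolP (l \in msupp f); last first.
    by rewrite if_same.
  by case: ifP => //; lia.
(* Each use of [shift] lowers the truncation level by [lam c - lam d], which is at least 1, until
   the truncation is empty. *)
have dvdF (j : nat) (i : int) : i <= - N%:Z + j%:Z -> exists h, F i = V * h.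
  elim: j i => [|j IHj] i le_i.
    by exists 0; rewrite mulr0 F_small //; lia.
  have [|h Fh] := IHj (i - (lam c - lam d)); first by lia.
  have := shift i; rewrite Fh => /(congr1 ( *%R (mono K (- d)))).
  rewrite mulrA -monoD addNr mono0 mul1r => ->.
  exists (mono K (- d) * (mono K c * h -
            ma_restr (fun l => lam l < i + lam d - lam a) g)).
  by ring.
have -> : f = F (N%:Z + 1).
  apply/malgP => l; rewrite mcoeff_restr.
  have [/le_N le_l|/mcoeff_outdom ->] := boolP (l \in msupp f); last first.
    by rewrite if_same.
  by case: ifP => //; lia.
by apply: (dvdF (N + N + 1)%N); lia.
Qed.

End GroupAlgebra.

Lemma seq_argmax (T : eqType) (lam : T -> int) (s : seq T) : s != [::] ->
  exists2 m, m \in s & forall x, x \in s -> lam x <= lam m.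
Proof.
elim: s => // x [|y s] IHs _.
  by exists x; rewrite ?mem_head // => z; rewrite inE => /eqP ->.
have [//|m m_s max_m] := IHs.
have [le_xm|lt_mx] := leP (lam x) (lam m).
  exists m; first by rewrite inE m_s orbT.
  by move=> z; rewrite inE => /predU1P[->|/max_m].
exists x; first exact: mem_head.
move=> z; rewrite inE => /predU1P[->//|/max_m le_zm].
exact: le_trans le_zm (ltW lt_mx).
Qed.

Section Domain.
Variables (K : idomainType) (L : zmodType) (n : nat).
Hypothesis HL : lattice_of_rank L n.
Local Notation KL := (monoid_algebra K L).

(** A linear form injective on the two supports orders their elements; the product of the two
    leading terms cannot be cancelled by any other pair. *)
Lemma ma_regular (f : KL) : f != 0 -> regular f.
Proof.
have [b basis_b] := HL.
move=> nz_f g fg0; apply: contraTeq isT => nz_g.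
pose s := (msupp f ++ msupp g : seq L).
have [x|lam nz_lam] := @generic_form _ _ _ basis_b
    [seq z <- [seq x - y | x <- s, y <- s] | z != 0].
  by rewrite mem_filter => /andP[].
have inj_lam x y : x \in s -> y \in s -> lam x = lam y -> x = y.
  move=> x_s y_s eq_xy; apply/eqP; rewrite -subr_eq0.
  apply: contraTT isT => nz_xy.
  have : lam (x - y) != 0.
    apply: nz_lam; rewrite mem_filter nz_xy.
    by apply/allpairsP; exists (x, y).
  by rewrite raddfB /= eq_xy subrr.
have supp0 (h : KL) : h != 0 -> enum_fset (msupp h) != [::].
  apply: contraNneq => h0; apply/eqP/malgP => l.
  rewrite mcoeff0 mcoeff_outdom //; apply/negP => l_h.
  by have : l \in enum_fset (msupp h) by []; rewrite h0.
have [k k_f max_k] := seq_argmax lam (supp0 _ nz_f).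
have [l l_g max_l] := seq_argmax lam (supp0 _ nz_g).
have : (f * g)@_(k + l) == 0 by rewrite fg0 mcoeff0.
rewrite mcoeffM_sum (bigD1_seq k) ?fset_uniq //= [k + l]addrC addrK.
rewrite big_seq_cond big1 => [|i /andP[i_f ne_ik]]; last first.
  have [/max_l|/mcoeff_outdom ->] := boolP (l + k - i \in msupp g).
    have -> : lam (l + k - i) = lam l + lam k - lam i.
      by rewrite (raddfB lam) (raddfD lam).
    move=> le_l; have le_i := max_k i i_f.
    case/eqP: ne_ik; apply: inj_lam; rewrite ?mem_cat ?i_f ?k_f //.
    apply/eqP; rewrite eq_le le_i /=.
    by move: le_l; rewrite -addrA gerDl subr_le0.
  by rewrite mulr0.
rewrite addr0 mulf_eq0 !mcoeff_eq0.
by rewrite k_f l_g.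
Qed.

End Domain.

(** * Lifting jets to the ring of invariants of the reflection subgroup *)

(** Induction on the size of [P], allowing a finite set [E] of exceptional points. The quotient of
    [P - P.[jK c0]] by ['X - jK c0] satisfies the hypothesis away from [c0], because [c - c0] is
    invertible in K; so [c0] joins [E]. *)
Lemma interpolation (K : fieldType) (S : comNzRingType)
    (jK : {rmorphism K -> S}) (infK : forall E : seq K, exists c, c \notin E)
    (d : S) (P : {poly S}) :
    (forall c, exists y, P.[jK c] = d * y) ->
  forall s, exists y, P.[s] = d * y.
Proof.
move=> dvdP s; have : exists E : seq K, forall c, c \notin E ->
    exists y, P.[jK c] = d * y by exists [::].
elim: (size P) {-2}P (leqnn (size P)) => [|m IHm] {dvdP}P.
  rewrite size_poly_leq0 => /eqP -> _.
  by exists 0; rewrite horner0 mulr0.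
move=> le_P [E dvdP]; have [c0 /dvdP[y0 Pc0]] := infK E.
have /factor_theorem[Q PQ] : root (P - P.[jK c0]%:P) (jK c0).
  by rewrite /root hornerD hornerN hornerC subrr.
have evP x : P.[x] = Q.[x] * (x - jK c0) + d * y0.
  have := congr1 (horner^~ x) PQ; rewrite hornerD hornerN hornerC hornerM.
  by rewrite hornerXsubC Pc0 => /eqP; rewrite subr_eq => /eqP.
have [||yQ sQ] := IHm Q.
- have [->|nzQ] := eqVneq Q 0; first by rewrite size_poly0.
  have : (size (Q * ('X - (jK c0)%:P))%R <= m.+1)%N; last first.
    by rewrite size_Mmonic ?monicXsubC // size_XsubC addn2.
  rewrite -PQ.
  apply: leq_trans (size_polyD _ _) _; rewrite geq_max le_P size_polyN.
  by rewrite (leq_trans (size_polyC_leq1 _)).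
- exists (c0 :: E) => c; rewrite inE negb_or => /andP[ne_c /dvdP[y Pc]].
  have unit_c : jK (c - c0)^-1 * jK (c - c0) = 1.
    by rewrite -rmorphM mulVf ?subr_eq0 // rmorph1.
  exists ((y - y0) * jK (c - c0)^-1).
  have := evP (jK c); rewrite Pc -rmorphB => /eqP.
  rewrite -subr_eq => /eqP eqQ.
  by rewrite mulrA mulrBr eqQ -mulrA [_ * jK _^-1]mulrC unit_c mulr1.
by exists (yQ * (s - jK c0) + y0); rewrite evP sQ; ring.
Qed.

Lemma prod_root_dvd (S : comNzRingType) (p : {poly S}) (rs : seq S) :
    (forall x y, x \in rs -> y \in rs -> x != y -> regular (x - y)) ->
    uniq rs -> (forall x, x \in rs -> p.[x] = 0) ->
  exists w, p = (\prod_(x <- rs) ('X - x%:P)) * w.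
Proof.
elim: rs p => [|x rs IHrs] p reg /=.
  by exists p; rewrite big_nil mul1r.
move=> /andP[x_rs uniq_rs] root_p.
have /factor_theorem[q pq] : root p x.
  by apply/eqP/root_p/mem_head.
have [y z y_rs z_rs||y y_rs|w qw] := IHrs q.
- by apply: reg; rewrite inE (y_rs, z_rs) orbT.
- exact: uniq_rs.
- have := root_p y; rewrite inE y_rs orbT => /(_ isT).
  rewrite pq hornerM hornerXsubC mulrC; apply: reg.
  + by rewrite inE y_rs orbT.
  + exact: mem_head.
  + by apply: contraNneq x_rs => <-.
by exists w; rewrite pq qw big_cons; ring.
Qed.

Section Galois.
Variables (G : finGroupType) (H : {group G}).
Hypothesis nHG : forall g, g \in 'N(H)%g.
Variables (R A S : comNzRingType) (iota : {rmorphism R -> A}).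
Variables (iA : {rmorphism A -> S}) (sigma : G -> {rmorphism S -> S}).
Hypothesis domS : forall s : S, s != 0 -> regular s.
Hypothesis sigma1 : forall s, sigma 1%g s = s.
Hypothesis sigmaM : forall g h s, sigma (g * h)%g s = sigma g (sigma h s).
Hypothesis iA_inj : injective iA.
Hypothesis iota_inj : injective iota.
Hypothesis fixA : forall a h, h \in H -> sigma h (iA a) = iA a.
Hypothesis fixR : forall g r, sigma g (iA (iota r)) = iA (iota r).
Hypothesis onR : forall s, (forall g, sigma g s = s) ->
  exists r, iA (iota r) = s.

Lemma sigmaK g s : sigma g^-1%g (sigma g s) = s.
Proof. by rewrite -sigmaM mulVg sigma1. Qed.

Lemma sigma_inj g : injective (sigma g).
Proof. exact: can_inj (sigmaK g). Qed.

(** The conjugates of [a] are indexed by G/H; the choice of representative is immaterial because H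
    fixes A. *)
Definition conjA (q : coset_of H) (a : A) : S := sigma (repr q) (iA a).

Lemma conjA_zmod_morphism q : zmod_morphism (conjA q).
Proof. by move=> x y; rewrite /conjA !rmorphB. Qed.
Lemma conjA_monoid_morphism q : monoid_morphism (conjA q).
Proof. by split=> [|x y]; rewrite /conjA ?rmorph1 // !rmorphM. Qed.
HB.instance Definition _ q := GRing.isZmodMorphism.Build A S (conjA q)
  (conjA_zmod_morphism q).
HB.instance Definition _ q := GRing.isMonoidMorphism.Build A S (conjA q)
  (conjA_monoid_morphism q).

Lemma sigma_coset g g' a : coset H g = coset H g' ->
  sigma g (iA a) = sigma g' (iA a).
Proof.
move=> eq_gg'; have [h h_H ->] : exists2 h, h \in H & g = (g' * h)%g.
  exists (g'^-1 * g)%g; last by rewrite mulKVg.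
  apply: coset_idr; first exact: nHG.
  by rewrite morphM ?morphV ?nHG //= eq_gg' mulVg.
by rewrite sigmaM fixA.
Qed.

Lemma conjA1 a : conjA 1%g a = iA a.
Proof. by rewrite /conjA repr_coset1 sigma1. Qed.

Lemma sigma_conjA g q a : sigma g (conjA q a) = conjA (coset H g * q)%g a.
Proof.
rewrite /conjA -sigmaM; apply: sigma_coset.
by rewrite coset_reprK morphM ?nHG // [X in (_ * X)%g]coset_reprK.
Qed.

Lemma poly_onR (p : {poly S}) : (forall g, map_poly (sigma g) p = p) ->
  exists p0, map_poly (iA \o iota) p0 = p.
Proof.
move=> inv_p; have ex i : exists r, iA (iota r) = p`_i.
  by apply: onR => g; rewrite -{2}(inv_p g) coef_map.
pose r i := sval (constructive_indefinite_description _ (ex i)).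
exists (\poly_(i < size p) r i); apply/polyP => i.
rewrite coef_map coef_poly; case: ltnP => [_|le_pi]; last first.
  by rewrite /= !rmorph0 nth_default.
by rewrite /= /r; case: constructive_indefinite_description.
Qed.

Definition discrA (b : A) : S := \prod_(q | q != 1%g) (iA b - conjA q b).

(** [f] is the product of the ['X - conjA q b], whose coefficients are G-invariant, so that
    [discrA b] is its derivative at [b]. The nonzero discriminant makes the conjugates of [b]
    distinct, whence [f] divides every polynomial over R vanishing at [b]. *)
Lemma galois_package b : discrA b != 0 -> exists f : {poly R},
  [/\ (map_poly iota f).[b] = 0,
      iA (map_poly iota f)^`().[b] = discrA b,
      forall a, exists q : {poly R},
        (map_poly iota q).[b] = (map_poly iota f)^`().[b] * a
    & forall p : {poly R}, (map_poly iota p).[b] = 0 ->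
        exists w, p = f * w].
Proof.
move=> nz_discr.
have reindexG g (op : Monoid.com_law (1 : {poly S})) F :
    \big[op/1]_q F (coset H g * q)%g = \big[op/1]_q F q.
  by rewrite [RHS](reindex_inj (mulgI (coset H g))).
pose F := \prod_q ('X - (conjA q b)%:P).
have mapF g : map_poly (sigma g) F = F.
  rewrite /F rmorph_prod /= -[RHS](reindexG g); apply: eq_bigr => q _.
  by rewrite rmorphB /= map_polyX map_polyC /= sigma_conjA.
have [f mapf] := poly_onR mapF.
have iA_horner p x : iA (map_poly iota p).[x] =
    (map_poly (iA \o iota) p).[iA x].
  by rewrite -horner_map map_poly_comp.
have F_split : F = ('X - (iA b)%:P) *
    \prod_(q | q != 1%g) ('X - (conjA q b)%:P).
  by rewrite /F (bigD1 1%g) //= conjA1.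
have rootF : F.[iA b] = 0 by rewrite F_split hornerM !hornerE subrr mul0r.
have discrE : (\prod_(q | q != 1%g) ('X - (conjA q b)%:P)).[iA b] = discrA b.
  by rewrite horner_prod; apply: eq_bigr => q _; rewrite !hornerE.
have f'b : iA (map_poly iota f)^`().[b] = discrA b.
  rewrite deriv_map iA_horner -deriv_map mapf F_split derivM.
  by rewrite derivXsubC mul1r !hornerE discrE subrr mul0r addr0.
have fb : (map_poly iota f).[b] = 0.
  by apply: iA_inj; rewrite iA_horner mapf rootF rmorph0.
exists f; split=> // [a|p pb].
  (* Lagrange's formula: [Q] takes the value [conjA q a] times the derivative of [F] at each
     [conjA q b], and G only permutes its terms. *)
  pose Q := \sum_q (conjA q a)%:P *
    \prod_(q' | q' != q) ('X - (conjA q' b)%:P).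
  have mapQ g : map_poly (sigma g) Q = Q.
    rewrite /Q rmorph_sum /= [RHS](reindex_inj (mulgI (coset H g))).
    apply: eq_bigr => q _; rewrite rmorphM /= map_polyC /= sigma_conjA.
    congr (_ * _); rewrite rmorph_prod /=.
    rewrite [RHS](reindex_inj (mulgI (coset H g))) /=.
    apply: eq_big => [q'|q' _]; first by rewrite (inj_eq (mulgI _)).
    by rewrite rmorphB /= map_polyX map_polyC /= sigma_conjA.
  have [q mapq] := poly_onR mapQ; exists q; apply: iA_inj.
  rewrite iA_horner mapq rmorphM f'b /Q horner_sum (bigD1 1%g) //=.
  rewrite hornerM hornerC discrE conjA1 mulrC big1 ?addr0 // => q' ne_q'.
  rewrite hornerM horner_prod (bigD1 1%g) 1?eq_sym //=.
  by rewrite hornerXsubC conjA1 subrr mul0r mulr0.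
have inj_conj q q' : conjA q b = conjA q' b -> q = q'.
  move=> eq_qq'; apply/eqP; rewrite eq_mulVg1; apply: contraNT nz_discr => nz.
  rewrite /discrA (bigD1 (q^-1 * q')%g nz) /=.
  have -> : conjA (q^-1 * q')%g b = iA b.
    rewrite -[(q^-1)%g]coset_reprK -sigma_conjA -eq_qq' sigma_conjA.
    by rewrite coset_reprK mulVg conjA1.
  by rewrite subrr mul0r.
have [x y|||W pW] := @prod_root_dvd _ (map_poly (iA \o iota) p)
    [seq conjA q b | q <- enum {: coset_of H}].
- by move=> _ _ ne_xy; apply: domS; rewrite subr_eq0.
- by rewrite map_inj_uniq ?enum_uniq.
- move=> _ /mapP[q _ ->]; rewrite /conjA.
  have -> : map_poly (iA \o iota) p =
            map_poly (sigma (repr q)) (map_poly (iA \o iota) p).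
    by apply/polyP => i; rewrite !coef_map /= fixR.
  by rewrite horner_map -iA_horner pb !rmorph0.
have {}pW : map_poly (iA \o iota) p = F * W.
  by rewrite pW big_map big_enum.
have monF : F \is monic by apply: monic_prod => q _; apply: monicXsubC.
(* Dividend and divisor are G-invariant and the divisor is monic, so the quotient is G-invariant
   too. *)
have [w mapw] : exists w, map_poly (iA \o iota) w = W.
  apply: poly_onR => g; apply: (monic_lreg monF); rewrite -pW -{1}(mapF g).
  rewrite -rmorphM /= -pW; apply/polyP => i.
  by rewrite !coef_map /= fixR.
exists w; apply: (map_inj_poly (inj_comp iA_inj iota_inj)).
  by rewrite /= !rmorph0.
by rewrite pW rmorphM /= mapf mapw.
Qed.

Section Lifting.
Variables (N : nat) (theta : {rmorphism R -> jet N S}).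
Hypothesis theta0 : forall r, jcoef 0 (theta r) = iA (iota r).

(* Rescaling [t] by the square of the discriminant clears the denominators of
   Hensel's lemma, so that no fraction field is needed. *)
Lemma local_lift b : discrA b != 0 ->
  exists Phi : {rmorphism A -> jet N S},
    (forall r, Phi (iota r) = jet_scale (discrA b ^+ 2) (theta r)) /\
    (forall a, jcoef 0 (Phi a) = iA a).
Proof.
move=> nz_b; have [f [fb dfb gen min]] := galois_package nz_b.
have [|r|Phi [PhiR Phi0]] := @extension_exists R A (jet N S) iota f b fb gen
    (jetX N S) N.+1 (jetX_nil N S) (jet_scale (discrA b ^+ 2) \o theta)
    (jetC N \o iA) _ _ min.
- by rewrite /= dfb; apply/jetC_regular/domS.
- have [y xy] := jet_split (theta r); exists (jet_scale (discrA b ^+ 2) y).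
  rewrite /= {1}xy rmorphD rmorphM /= jet_scaleC jet_scaleX theta0 dfb.
  by rewrite rmorphXn.
exists Phi; split=> // a; have [e ->] := Phi0 a.
rewrite jcoefD jcoefC /=; suff -> : jcoef 0 (jetX N S * e) = 0.
  by rewrite addr0.
by rewrite -[e]to_jetK -rmorphM jcoef_to_jet // coefXM.
Qed.

(** Equal constant terms make the two images of [b] differ by a multiple of t, as [extension_unique]
    requires. The twist by [g] serves to compare a lift with its conjugates. *)
Lemma lift_unique b g (chi1 chi2 : {rmorphism A -> jet N S}) :
    discrA b != 0 -> (forall r, chi1 (iota r) = chi2 (iota r)) ->
    (forall a, jcoef 0 (chi1 a) = sigma g (iA a)) ->
    (forall a, jcoef 0 (chi2 a) = sigma g (iA a)) ->
  chi1 =1 chi2.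
Proof.
move=> nz_b eqR chi1_0 chi2_0.
have [f [fb dfb gen _]] := galois_package nz_b.
have [y1 y1E] := jet_split (chi1 b); have [y2 y2E] := jet_split (chi2 b).
apply: (extension_unique fb gen (jetX_nil N S) (z := y1 - y2)) => //.
  by rewrite y1E y2E chi1_0 chi2_0; ring.
have [y ->] := jet_split (chi2 (map_poly iota f)^`().[b]).
apply: (regular_add_nilpotent (jetX_nil N S)); apply/jetC_regular/domS.
by rewrite chi2_0 dfb; apply: contraNneq nz_b => eq0; apply/eqP/(@sigma_inj g);
  rewrite rmorph0.
Qed.

End Lifting.

Variables (K : fieldType) (jK : {rmorphism K -> S}).
Hypothesis infK : forall E : seq K, exists c, c \notin E.
Hypothesis fixK : forall g c, sigma g (jK c) = jK c.
Hypothesis onA : forall s, (forall h, h \in H -> sigma h s = s) ->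
  exists a, iA a = s.

Definition norm_poly s : {poly S} := \prod_(h in H) ('X - (sigma h s)%:P).

(* Its value at [c] in [K] is the discriminant of the [H]-invariant
   [(norm_poly s).[c]], and its value at [s] is, up to sign, the product of the
   [s - sigma g s] over the [g] outside [H]. *)
Definition discr_poly s : {poly S} :=
  \prod_(q : coset_of H | q != 1%g)
     (norm_poly s - map_poly (sigma (repr q)) (norm_poly s)).

Lemma norm_poly_root s : (norm_poly s).[s] = 0.
Proof.
rewrite /norm_poly (bigD1 1%g) ?group1 //= hornerM hornerXsubC sigma1 subrr.
by rewrite mul0r.
Qed.

Lemma map_norm_poly g s :
  map_poly (sigma g) (norm_poly s) =
  \prod_(h in H) ('X - (sigma (g * h)%g s)%:P).
Proof.
rewrite rmorph_prod; apply: eq_bigr => h _.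
by rewrite rmorphB /= map_polyX map_polyC /= sigmaM.
Qed.

Lemma norm_elt s c : exists a, iA a = (norm_poly s).[jK c].
Proof.
apply: onA => h h_H; rewrite -[jK c in RHS](fixK h) -horner_map /= fixK.
congr _.[_]; rewrite map_norm_poly [RHS](reindex_inj (mulgI h)) /=.
by apply: eq_bigl => h'; rewrite groupMl.
Qed.

Lemma discr_norm_elt s c a : iA a = (norm_poly s).[jK c] ->
  discrA a = (discr_poly s).[jK c].
Proof.
move=> ac; rewrite /discrA /discr_poly horner_prod; apply: eq_bigr => q _.
by rewrite hornerD hornerN /conjA ac -horner_map fixK.
Qed.

Lemma discr_poly_self s : (discr_poly s).[s] =
  \prod_(q : coset_of H | q != 1%g)
    (- \prod_(h in H) (s - sigma (repr q * h)%g s)).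
Proof.
rewrite /discr_poly horner_prod; apply: eq_bigr => q _.
rewrite hornerD hornerN norm_poly_root add0r map_norm_poly horner_prod.
by under eq_bigr do rewrite hornerXsubC.
Qed.

Variables s1 s2 : S.
Hypothesis discr_coprime : forall m x y,
  (discr_poly s1).[s1] ^+ m * x = (discr_poly s2).[s2] ^+ m * y ->
  exists z, x = (discr_poly s2).[s2] ^+ m * z.
Hypothesis discr_neq0 : (discr_poly s2).[s2] != 0.

(** Otherwise [discr_poly s2] would vanish at every point of K, and interpolation with divisor 0
    would make it vanish at [s2]. *)
Lemma exists_discr : exists b, discrA b != 0.
Proof.
apply: NNPP => no_b; case/eqP: discr_neq0.
have [c|y ->] := @interpolation _ _ jK infK 0 (discr_poly s2) _ s2.
  have [a ac] := norm_elt s2 c; exists 0; rewrite mul0r -(discr_norm_elt ac).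
  by apply: NNPP => /eqP nz; apply: no_b; exists a.
by rewrite mul0r.
Qed.

(** [Phi0] lifts [theta] only after rescaling t by [discrA b0 ^+ 2]. To undo the rescaling, its
    coefficient of degree k must be divisible by [(discrA b0 ^+ 2) ^+ k]; this is obtained by
    comparison with the lifts for other elements [b]. *)
Lemma global_lift N (theta : {rmorphism R -> jet N S}) :
    (forall r, jcoef 0 (theta r) = iA (iota r)) ->
  exists Phi : {rmorphism A -> jet N S},
    (forall r, Phi (iota r) = theta r) /\ (forall a, jcoef 0 (Phi a) = iA a).
Proof.
move=> theta0; have [b0 nz_b0] := exists_discr.
have [Phi0 [Phi0R Phi0_0]] := local_lift theta0 nz_b0.
(* Rescaling the lifts for [b] and [b0] each by the squared discriminant of the other gives two
   extensions of one morphism, which agree. *)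
have compare b a k : discrA b != 0 -> (k <= N)%N -> exists y,
    (discrA b ^+ 2) ^+ k * jcoef k (Phi0 a) = (discrA b0 ^+ 2) ^+ k * y.
  move=> nz_b le_kN; have [Phi [PhiR Phi_0]] := local_lift theta0 nz_b.
  exists (jcoef k (Phi a)); rewrite -!jcoef_scale //; congr jcoef.
  apply: (lift_unique (chi1 := jet_scale (discrA b ^+ 2) \o Phi0)
           (chi2 := jet_scale (discrA b0 ^+ 2) \o Phi) (g := 1%g) nz_b).
  - move=> r /=; rewrite Phi0R PhiR; apply: jetP => j le_jN.
    by rewrite !jcoef_scale // mulrCA.
  - by move=> a' /=; rewrite jcoef_scale // expr0 mul1r sigma1.
  - by move=> a' /=; rewrite jcoef_scale // expr0 mul1r sigma1.
(* At a point c of K, [discr_poly s] is the discriminant of the element [(norm_poly s).[jK c]] of A,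
   to which [compare] applies; interpolation then replaces c by [s]. *)
have dvd_self s a k : (k <= N)%N -> exists y,
    ((discr_poly s).[s] ^+ 2) ^+ k * jcoef k (Phi0 a) =
    (discrA b0 ^+ 2) ^+ k * y.
  move=> le_kN; have [c|y yE] := @interpolation _ _ jK infK
      ((discrA b0 ^+ 2) ^+ k)
      ((discr_poly s ^+ 2) ^+ k * (jcoef k (Phi0 a))%:P) _ s.
    have [b bc] := norm_elt s c; rewrite hornerM hornerC !horner_exp.
    rewrite -(discr_norm_elt bc); have [db0|] := eqVneq (discrA b) 0.
      (* There is no lift to compare with when the discriminant vanishes, but then the left side is
         zero for positive k, and for k = 0 both powers are 1. *)
      case: k le_kN => [|k] _; first by exists (jcoef 0 (Phi0 a)).
      by exists 0; rewrite db0 !expr0n /= mul0r mulr0.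
    by move=> nz_b; apply: compare.
  by exists y; rewrite -yE hornerM hornerC !horner_exp.
have reg_d0 k : regular ((discrA b0 ^+ 2) ^+ k).
  by do 2!apply: regularX; apply: domS.
have ex_D a k : exists D, (k <= N)%N ->
    jcoef k (Phi0 a) = (discrA b0 ^+ 2) ^+ k * D.
  have [le_kN|_] := leqP k N; last by exists 0.
  have [x xE] := dvd_self s2 a k le_kN; have [y yE] := dvd_self s1 a k le_kN.
  (* Eliminating the coefficient between [xE] and [yE] relates [x] and [y]; coprimality then makes
     [x] divisible by the power of the discriminant at [s2], which cancels in [xE]. *)
  have [|z zE] := @discr_coprime (2 * k)%N x y.
    apply: (regular_inj (reg_d0 k)); rewrite /= [LHS]mulrCA -xE.
    by rewrite [RHS]mulrCA -yE !exprM; ring.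
  exists z => _; have reg_2 : regular (((discr_poly s2).[s2] ^+ 2) ^+ k).
    by do 2!apply: regularX; apply: domS.
  by apply: (regular_inj reg_2); rewrite /= xE zE exprM; ring.
pose D a k := sval (constructive_indefinite_description _ (ex_D a k)).
have DE a k : (k <= N)%N -> jcoef k (Phi0 a) = (discrA b0 ^+ 2) ^+ k * D a k.
  by rewrite /D; case: constructive_indefinite_description.
pose Phi a : jet N S := \sum_(i < N.+1) jetC N (D a i) * jetX N S ^+ i.
have PhiE a : jet_scale (discrA b0 ^+ 2) (Phi a) = Phi0 a.
  by apply: jetP => k le_kN; rewrite jcoef_scale // jcoef_sum // DE.
have inj_scale : injective (@jet_scale N S (discrA b0 ^+ 2)).
  move=> x y eq_xy; apply: jetP => k le_kN; apply: (regular_inj (reg_d0 k)).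
  by rewrite /= -!jcoef_scale // eq_xy.
have Phi_zmod : zmod_morphism Phi.
  by move=> x y; apply: inj_scale; rewrite rmorphB /= !PhiE rmorphB.
have Phi_monoid : monoid_morphism Phi.
  split=> [|x y]; apply: inj_scale; first by rewrite PhiE !rmorph1.
  by rewrite rmorphM /= !PhiE rmorphM.
pose PhiA := GRing.isZmodMorphism.Build A (jet N S) Phi Phi_zmod.
pose PhiM := GRing.isMonoidMorphism.Build A (jet N S) Phi Phi_monoid.
pose PhiRM : {rmorphism A -> jet N S} := HB.pack Phi PhiA PhiM.
exists PhiRM; split=> [r|a] /=.
  by apply: inj_scale; rewrite PhiE Phi0R.
by rewrite /Phi jcoef_sum // -Phi0_0 DE // expr0 mul1r.
Qed.

Variables (alpha : G -> {rmorphism A -> A}) (eps : {rmorphism S -> K}).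
Hypothesis iA_alpha : forall g a, iA (alpha g a) = sigma g (iA a).
Hypothesis eps_sigma : forall g s, eps (sigma g s) = eps s.
Hypothesis separating_jets : forall r, r != 0 ->
  exists N (theta : {rmorphism R -> jet N S}),
    [/\ forall r, jcoef 0 (theta r) = iA (iota r),
        forall g r, jet_map (sigma g) (theta r) = theta r
      & exists2 k, (k <= N)%N & eps (jcoef k (theta r)) != 0].

Theorem conjugation_trivial g a : alpha g a = a.
Proof.
apply/eqP; rewrite -subr_eq0; set u := alpha g a - a.
apply: contraTT isT => nz_u; pose v := \prod_x alpha x u.
have iAv : iA v = \prod_x sigma x (iA u).
  by rewrite rmorph_prod; apply: eq_bigr => x _; rewrite /= iA_alpha.
have [r rE] : exists r, iA (iota r) = iA v.
  apply: onR => x; rewrite iAv rmorph_prod [RHS](reindex_inj (mulgI x)) /=.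
  by apply: eq_bigr => y _; rewrite sigmaM.
have {}rE : iota r = v by apply: iA_inj.
have nz_iAu : iA u != 0.
  by apply: contraNneq nz_u => u0; apply/eqP/iA_inj; rewrite rmorph0.
have nz_r : r != 0.
  apply/eqP => r0; case/eqP: (oner_neq0 S).
  have : regular (iA v).
    rewrite iAv; apply: regular_bigprod => x _; apply: domS.
    apply: contraNneq nz_iAu => u0; apply/eqP/(@sigma_inj x).
    by rewrite rmorph0.
  by apply; rewrite -rE r0 !rmorph0 mul0r.
have [N [theta [theta0 theta_fix [k le_kN]]]] := separating_jets nz_r.
case/negP; apply/eqP; have [Phi [PhiR Phi0]] := global_lift theta0.
have [b nz_b] := exists_discr.
(* Both sides extend [theta], whose values are fixed by G, and both have constant term
   [sigma g (iA a')]. *)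
have equiv a' : jet_map (sigma g) (Phi a') = Phi (alpha g a').
  apply: (lift_unique (chi1 := jet_map (sigma g) \o Phi)
           (chi2 := Phi \o alpha g) (g := g) nz_b) => [r'|a''|a''] /=.
  - rewrite PhiR theta_fix -PhiR; congr (Phi _); apply: iA_inj.
    by rewrite iA_alpha fixR.
  - by rewrite jcoef_map // Phi0.
  - by rewrite Phi0 iA_alpha.
(* By [equiv], [Phi (alpha g a)] is conjugate to [Phi a], and [eps] does not distinguish
   conjugates. *)
have u0 : jet_map eps (Phi u) = 0.
  rewrite !rmorphB /= -equiv; apply/eqP; rewrite subr_eq0; apply/eqP.
  by apply: jetP => j le_jN; rewrite !jcoef_map // eps_sigma.
rewrite -jcoef_map // -PhiR rE rmorph_prod (bigD1 1%g) //=.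
have -> : alpha 1%g u = u by apply: iA_inj; rewrite iA_alpha sigma1.
by rewrite rmorphM /= u0 mul0r /jcoef coef0.
Qed.

End Galois.

(** * Jets on mixed Laurent polynomial rings *)

Section IntPower.
Variables (E : comNzRingType) (u v : E).
Hypothesis uv1 : u * v = 1.

(** [E] is a mere commutative ring, so the inverse of [u] is supplied as [v]; the proof argument
    serves to infer it. *)
Definition zpow of u * v = 1 := fun a : int =>
  match a with Posz k => u ^+ k | Negz k => v ^+ k.+1 end.

Lemma zpowB (x y : nat) : zpow uv1 (x%:Z - y%:Z) = u ^+ x * v ^+ y.
Proof.
have uvX k : u ^+ k * v ^+ k = 1 by rewrite -exprMn uv1 expr1n.
have [le_yx|lt_xy] := leqP y x.
  have -> : x%:Z - y%:Z = Posz (x - y) by lia.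
  by rewrite /= -[in RHS](subnK le_yx) exprD -mulrA uvX mulr1.
have -> : x%:Z - y%:Z = Negz (y - x).-1 by lia.
rewrite /= prednK ?subn_gt0 // -[in RHS](subnK (ltnW lt_xy)) addnC.
by rewrite exprD mulrA uvX mul1r.
Qed.

Lemma zpowD : {morph zpow uv1 : a b / a + b >-> a * b}.
Proof.
have ex (a : int) : exists x y : nat, a = x%:Z - y%:Z.
  by case: a => k; [exists k, 0%N | exists 0%N, k.+1]; lia.
move=> a b; have [x [y ->]] := ex a; have [x' [y' ->]] := ex b.
have -> : x%:Z - y%:Z + (x'%:Z - y'%:Z) = (x + x')%N%:Z - (y + y')%N%:Z by lia.
by rewrite !zpowB !exprD; ring.
Qed.

End IntPower.

Lemma infinite_nonroot (K : fieldType)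
    (infK : forall E : seq K, exists c, c \notin E) (p : {poly K}) :
  p != 0 -> exists x, p.[x] != 0.
Proof.
move=> nz_p.
have [s [uniq_s size_s]] : exists s : seq K, uniq s /\ size s = size p.
  elim: (size p) => [|k [s [uniq_s <-]]]; first by exists [::].
  by have [c c_s] := infK s; exists (c :: s); rewrite /= c_s.
apply: NNPP => no_x; have all_s : all (root p) s.
  apply/allP => x _; rewrite /root; apply/negPn/negP => nz.
  by apply: no_x; exists x.
by have := max_poly_roots nz_p all_s uniq_s; rewrite size_s ltnn.
Qed.

Lemma absz_shift (a : int) (c : nat) : (`|a| <= c)%N ->
  (absz (a + c%:Z)%R)%:Z = a + c%:Z.
Proof. lia. Qed.

Section MixedLaurent.
Variables (K : fieldType) (k m : nat).
Hypothesis infK : forall E : seq K, exists c, c \notin E.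
Local Notation M := ({ffun 'I_k -> int} * {ffun 'I_m -> nat})%type.
Local Notation ML := (monoid_algebra K M).

Definition zvar (j : 'I_m) : M := (0, [ffun j' => (j == j')%:R]).

Lemma mono_nat (b : {ffun 'I_m -> nat}) :
  mono K ((0, b) : M) = \prod_j mono K (zvar j) ^+ b j.
Proof.
have -> : ((0, b) : M) = \sum_j zvar j *+ b j.
  have sumE (r : seq 'I_m) : \sum_(j <- r) zvar j *+ b j =
      (0, \sum_(j <- r) [ffun j' => (j == j')%:R] *+ b j) :> M.
    elim: r => [|j r IHr]; first by rewrite !big_nil.
    rewrite !big_cons IHr; have -> : zvar j *+ b j =
        (0, [ffun j' => (j == j')%:R] *+ b j) :> M; last first.
      by congr (_, _); rewrite addr0.
    elim: (b j) => [|c IHc]; first by rewrite !mulr0n.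
    rewrite !mulrS IHc; by congr (_, _); rewrite addr0.
  rewrite sumE; congr (_, _); apply/ffunP => j; rewrite sum_ffunE.
  rewrite (bigD1 j) //= big1 => [|i ne_ij]; rewrite ffunMnE ffunE.
    by rewrite eqxx addr0; exact/esym/natn.
  by rewrite (negPf ne_ij) mul0rn.
elim/big_rec2: _ => [//|j x y _ IH]; rewrite monoD IH; congr (_ * _).
by elim: (b j) => [//|c IHc]; rewrite mulrS exprS monoD IHc.
Qed.

Section Theta.
Variables (N : nat) (w : 'I_k -> K) (v : 'I_m -> K).
Local Notation J := (jet N ML).

Let cst (a : K) : J := jetC N (a%:A).

Fact unit_ex i : exists u, (1 + jetX N ML * cst (w i)) * u = 1.
Proof. exact: unit_add_nilpotent (jetX_nil N ML) _. Qed.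
Let unit_inv i := sval (constructive_indefinite_description _ (unit_ex i)).
Fact unit_invP i : (1 + jetX N ML * cst (w i)) * unit_inv i = 1.
Proof. exact: svalP (constructive_indefinite_description _ (unit_ex i)). Qed.

(* The substitution [y_i -> y_i (1 + w_i t)] in the invertible variables and
   [z_j -> z_j + v_j t] in the others. *)
Definition shift (l : M) : J :=
  jetC N (mono K ((l.1, 0) : M)) * (\prod_i zpow (unit_invP i) (l.1 i)) *
  \prod_j (jetC N (mono K (zvar j)) + jetX N ML * cst (v j)) ^+ l.2 j.

Lemma shift0 : shift 0 = 1.
Proof.
rewrite /shift !big1 => [|i _|j _]; rewrite ?ffunE ?expr0 //.
by rewrite !mulr1 mono0 rmorph1.
Qed.

Lemma shiftD : {morph shift : x y / x + y >-> x * y}.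
Proof.
move=> [a b] [a' b']; rewrite /shift /=.
have -> : ((a + a', 0) : M) = (a, 0) + (a', 0) by congr (_, _); rewrite addr0.
rewrite monoD rmorphM /=.
under eq_bigr do rewrite ffunE zpowD.
under [X in _ * X = _]eq_bigr do rewrite ffunE exprD.
by rewrite !big_split /= [X in X * _ = _]mulrACA [LHS]mulrACA.
Qed.

Lemma const_zmod_morphism : zmod_morphism cst.
Proof. by move=> x y; rewrite /cst scalerBl rmorphB. Qed.
Lemma const_monoid_morphism : monoid_morphism cst.
Proof.
split=> [|x y]; rewrite /cst ?scale1r ?rmorph1 // -rmorphM.
by rewrite -scalerAl mul1r scalerA.
Qed.
HB.instance Definition _ := GRing.isZmodMorphism.Build K J cst
  const_zmod_morphism.
HB.instance Definition _ := GRing.isMonoidMorphism.Build K J cst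
  const_monoid_morphism.

Definition theta : {rmorphism ML -> J} := ma_lift cst shift0 shiftD.

Lemma theta_mono l : theta (mono K l) = shift l.
Proof. exact: ma_lift_mono. Qed.

Lemma thetaZ a f : theta (a *: f) = cst a * theta f.
Proof. exact: ma_liftZ. Qed.

Lemma theta_id x : jcoef 0 (theta x) = x.
Proof.
have nil0 : (0 : ML) ^+ N.+1 = 0 by rewrite expr0n.
(* Reading the constant coefficient is evaluation at t = 0, hence a ring morphism. *)
have ev0 y : jcoef 0 y = jet_eval (idfun : {rmorphism ML -> ML}) nil0 y.
  rewrite jet_evalE big_ord_recl expr0 mulr1 big1 ?addr0 // => i _.
  by rewrite expr0n mulr0.
have -> : theta x = \sum_(l <- msupp x) cst x@_l * shift l by [].
rewrite ev0 [in RHS](ma_expand x) rmorph_sum.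
apply: eq_bigr => l _ /=; rewrite rmorphM /= jet_evalC /=.
rewrite -scalerAl mul1r; congr (_ *: _).
rewrite /shift !rmorphM !rmorph_prod /= jet_evalC /=.
rewrite [X in _ * X * _]big1 => [|i _]; last first.
  have ev_u : jet_eval (idfun : {rmorphism ML -> ML}) nil0
      (1 + jetX N ML * cst (w i)) = 1.
    by rewrite rmorphD rmorphM rmorph1 /= jet_evalX mul0r addr0.
  have ev_v : jet_eval (idfun : {rmorphism ML -> ML}) nil0 (unit_inv i) = 1.
    have := congr1 (jet_eval (idfun : {rmorphism ML -> ML}) nil0) (unit_invP i).
    by rewrite rmorphM rmorph1 /= ev_u mul1r.
  by case: (l.1 i) => e /=; rewrite rmorphXn /= ?ev_u ?ev_v expr1n.
rewrite mulr1; case: l => a b /=.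
under eq_bigr do
  rewrite rmorphXn rmorphD rmorphM /= jet_evalX mul0r addr0 jet_evalC.
rewrite -mono_nat -monoD; congr mono; congr (_, _); by rewrite ?addr0 ?add0r.
Qed.

Variable p : {rmorphism ML -> K}.
Hypothesis pC : forall a, p a%:A = a.

(** For nonnegative exponents the jet is the class of an explicit polynomial in t, which can be
    evaluated at t = 1. *)
Lemma theta_eval_nonneg (e : {ffun 'I_k -> nat}) b :
  jet_map p (theta (mono K (([ffun i => (e i)%:Z], b) : M))) =
  to_jet N ((p (mono K (([ffun i => (e i)%:Z], 0) : M)))%:P *
    (\prod_i (1 + 'X * (w i)%:P) ^+ e i) *
    \prod_j ((p (mono K (zvar j)))%:P + 'X * (v j)%:P) ^+ b j).
Proof.
rewrite theta_mono /shift !rmorphM !rmorph_prod /= to_jetC jet_mapC.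
congr (_ * _ * _); apply: eq_bigr => i _; rewrite ?ffunE /=.
  rewrite !rmorphXn !rmorphD !rmorphM !rmorph1 /= jet_mapX jet_mapC pC.
  by rewrite to_jetC.
by rewrite !rmorphXn !rmorphD !rmorphM /= jet_mapX !jet_mapC pC !to_jetC.
Qed.

End Theta.

Theorem separating_jet (p : {rmorphism ML -> K}) (r : ML) :
    (forall a, p a%:A = a) -> r != 0 ->
  exists N (theta : {rmorphism ML -> jet N ML}),
    [/\ forall x, jcoef 0 (theta x) = x
      & exists2 j, (j <= N)%N & p (jcoef j (theta r)) != 0].
Proof.
move=> pC nz_r.
pose s : seq M := msupp r.
have nz_s : exists l0, l0 \in s.
  apply: NNPP => no_l; case/eqP: nz_r; apply/malgP => l.
  by rewrite mcoeff0 mcoeff_outdom //; apply/negP => l_s; apply: no_l; exists l.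
(* [B] bounds the exponents of the invertible variables, so multiplying [r] by all of them to the
   power [B] leaves no negative exponent. *)
pose B : nat := \sum_(l <- s) \sum_i `|l.1 i|%N.
have le_B l i : l \in s -> (`|l.1 i| <= B)%N.
  move=> l_s; rewrite /B (big_rem l) //= (bigD1 i) //=.
  by rewrite -addnA leq_addr.
pose vec (l : M) (i : 'I_(k + m)) : int :=
  match split i with inl i => l.1 i | inr j => (l.2 j)%:Z end.
have vecL l i : vec l (lshift m i) = l.1 i by rewrite /vec (unsplitK (inl i)).
have vecR l j : vec l (rshift k j) = (l.2 j)%:Z.
  by rewrite /vec (unsplitK (inr j)).
(* The weights [Mo ^ i] are to separate any two distinct exponents in the support of [r]. *)
pose D := [seq ll <- [seq (l, l') | l <- s, l' <- s] | ll.1 != ll.2].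
have [c|Mo gen] := @generic_moment (k + m) _
    (fun (c : 'I_(size D)) i => vec (tnth (in_tuple D) c).1 i -
                                vec (tnth (in_tuple D) c).2 i).
  have : tnth (in_tuple D) c \in D by apply: mem_tnth.
  rewrite mem_filter => /andP[ne_ll _]; apply: NNPP => no_i.
  have eq_i i : vec (tnth (in_tuple D) c).1 i = vec (tnth (in_tuple D) c).2 i.
    apply/eqP; rewrite -subr_eq0; apply/negPn/negP => nz.
    by apply: no_i; exists i.
  case/eqP: ne_ll; case: (tnth _ c) eq_i => [[a b] [a' b']] /= eq_i.
  congr (_, _); apply/ffunP => j.
    by have := eq_i (lshift _ j); rewrite !vecL.
  by have := eq_i (rshift _ j); rewrite !vecR => -[].
pose sh (l : M) : {ffun 'I_k -> nat} := [ffun i => absz (l.1 i + B%:Z)%R].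
pose Ex (l : M) : nat :=
  ((\sum_i sh l i * Mo ^ i) + (\sum_j l.2 j * Mo ^ (k + j)))%N.
have ExE l : l \in s -> (Ex l)%:Z =
    \sum_i vec l i * Mo%:Z ^+ i + \sum_(i < k) B%:Z * Mo%:Z ^+ i.
  move=> l_s; rewrite big_split_ord /= addrAC -big_split /= PoszD.
  congr (_ + _); rewrite -[LHS]natz natr_sum; apply: eq_bigr => i _.
    rewrite vecL natrM natrX !natz ffunE -mulrDl; congr (_ * _).
    exact/absz_shift/le_B.
  by rewrite vecR natrM natrX !natz.
have inj_Ex l l' : l \in s -> l' \in s -> Ex l = Ex l' -> l = l'.
  move=> l_s l'_s eq_E; apply/eqP; apply: contraTT isT => ne_ll'.
  have ll'_D : (l, l') \in D.
    by rewrite mem_filter ne_ll'; apply/allpairsP; exists (l, l').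
  have /tnthP[c cE] : (l, l') \in in_tuple D by [].
  case/eqP: (gen c); rewrite -cE /=.
  have /eqP := congr1 Posz eq_E; rewrite !ExE // (inj_eq (addIr _)) => /eqP eqE.
  by under eq_bigr do rewrite mulrBl; rewrite sumrB eqE subrr.
pose cf (l : M) : K := r@_l * p (mono K (([ffun i => (sh l i)%:Z], 0) : M)).
have nz_cf l : l \in s -> cf l != 0.
  move=> l_s; rewrite mulf_neq0 ?mcoeff_neq0 //.
  (* A ring morphism to K cannot kill an invertible monomial. *)
  set a := finfun _; apply/eqP => pa0; case/eqP: (oner_neq0 K).
  have -> : 1 = p (mono K ((a, 0) : M)) * p (mono K ((- a, 0) : M)).
    rewrite -rmorphM -monoD -(rmorph1 p) -mono0; congr (p (mono K _)).
    by congr (_, _); rewrite ?addrN ?addr0.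
  by rewrite pa0 mul0r.
pose Q : {poly K} := \sum_(l <- s) (cf l)%:P * 'X^(Ex l).
have nz_Q : Q != 0.
  have [l0 l0_s] := nz_s; apply: contraNneq (nz_cf l0 l0_s) => Q0.
  have := congr1 (coefp (Ex l0)) Q0; rewrite /= coef0 coef_sum.
  rewrite (bigD1_seq l0) ?fset_uniq //= coefCM coefXn eqxx mulr1.
  rewrite big_seq_cond big1 ?addr0 => [->//|l /andP[l_s ne_l]].
  rewrite coefCM coefXn; case: eqP => [eqE|_]; last by rewrite mulr0.
  by case/eqP: ne_l; apply: inj_Ex.
have [x Qx] := infinite_nonroot infK nz_Q.
(* At [t = 1], [y_i] takes the value [p(y_i) x^(Mo^i)] and [z_j] the value
   [x^(Mo^(k + j))], so that the monomials of [r] become distinct powers of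
   [x]. *)
pose w (i : 'I_k) : K := x ^+ (Mo ^ i) - 1.
pose v (j : 'I_m) : K := x ^+ (Mo ^ (k + j)) - p (mono K (zvar j)).
pose P : {poly K} := \sum_(l <- s) (r@_l)%:P *
  ((p (mono K (([ffun i => (sh l i)%:Z], 0) : M)))%:P *
    (\prod_i (1 + 'X * (w i)%:P) ^+ sh l i) *
    \prod_j ((p (mono K (zvar j)))%:P + 'X * (v j)%:P) ^+ l.2 j).
have P1 : P.[1] = Q.[x].
  rewrite !horner_sum; apply: eq_bigr => l _.
  rewrite !hornerM !hornerC !horner_prod hornerXn /cf -!mulrA.
  congr (_ * (_ * _)); rewrite /Ex exprD; congr (_ * _).
    rewrite -prodrXr; apply: eq_bigr => i _.
    rewrite horner_exp hornerD hornerM hornerX !hornerC mul1r /w.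
    by rewrite addrC subrK -exprM mulnC.
  rewrite -prodrXr; apply: eq_bigr => i _.
  rewrite horner_exp hornerD hornerM hornerX !hornerC mul1r /v.
  by rewrite addrC subrK -exprM mulnC.
(* Truncation at this order loses no coefficient of [P]. *)
exists (size P), (theta (size P) w v); split; first exact: theta_id.
apply: NNPP => no_j; case/eqP: Qx; rewrite -P1.
pose Bm : M := ([ffun=> B%:Z], 0).
pose psi y := jet_map p (theta (size P) w v y).
have psiM x1 x2 : psi (x1 * x2) = psi x1 * psi x2.
  by rewrite /psi (rmorphM (theta _ _ _)) (rmorphM (jet_map p)).
have psi_sum (t : seq M) (F : M -> ML) :
    psi (\sum_(l <- t) F l) = \sum_(l <- t) psi (F l).
  by rewrite /psi (rmorph_sum (theta _ _ _)) (rmorph_sum (jet_map p)).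
have psiZ a y : psi (a *: y) = jetC _ a * psi y.
  rewrite /psi thetaZ (rmorphM (jet_map p)); congr (_ * _).
  by rewrite /= jet_mapC pC.
(* If [p] detected no coefficient of [theta r], then [P], whose class is [psi (mono K Bm * r)],
   would vanish, against the nonzero value of [P] at 1. *)
have psi0 : psi (mono K Bm * r) = 0.
  rewrite psiM; suff -> : psi r = 0 by rewrite mulr0.
  apply: jetP => j le_j; rewrite jcoef_map // [RHS]coef0.
  by apply: NNPP => /eqP nz; apply: no_j; exists j.
have jet_sumE (t : seq M) (F : M -> {poly K}) :
    to_jet (size P) (\sum_(l <- t) F l) = \sum_(l <- t) to_jet (size P) (F l).
  by rewrite (rmorph_sum (@to_jet _ _)).
have jetCM c q : to_jet (size P) (c%:P * q) = jetC _ c * to_jet (size P) q.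
  by rewrite rmorphM /= to_jetC.
suff PE : to_jet (size P) P = 0.
  have -> : P = 0; last by rewrite horner0.
  apply/polyP => j; rewrite coef0; have [le_j|lt_j] := leqP j (size P).
    by rewrite -(jcoef_to_jet _ le_j) PE /jcoef coef0.
  by rewrite nth_default // ltnW.
rewrite -psi0 [in RHS](ma_expand r) mulr_sumr psi_sum.
rewrite jet_sumE.
rewrite big_seq [RHS]big_seq; apply: eq_bigr => l l_s.
rewrite -scalerAr psiZ jetCM; congr (_ * _).
rewrite -monoD; have -> : Bm + l = ([ffun i => (sh l i)%:Z], l.2).
  case: l l_s => a b l_s; congr (_, _); last by rewrite /= add0r.
  by apply/ffunP => i; rewrite !ffunE addrC absz_shift //; apply: (le_B (a, b)).
by rewrite /psi theta_eval_nonneg.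
Qed.

End MixedLaurent.

(** * The reflection subgroup *)

Lemma closed_field_infinite (K : closedFieldType) (E : seq K) :
  exists c, c \notin E.
Proof.
(* The factor ['X] keeps [p] nonconstant when [E] is empty. *)
pose p : {poly K} := \prod_(e <- E) ('X - e%:P) * 'X + 1.
have szE : size (\prod_(e <- E) ('X - e%:P)) = (size E).+1.
  by rewrite size_prod_XsubC.
have szp : size p = (size E).+2.
  by rewrite size_polyDl size_mulX ?szE -?size_poly_gt0 ?szE ?size_poly1.
have /closed_rootP[c pc] : size p != 1%N by rewrite szp.
exists c; apply/negP => c_E; move: pc; rewrite /root hornerD hornerM hornerC.
have /eqP -> : root (\prod_(e <- E) ('X - e%:P)) c by rewrite root_prod_XsubC.
by rewrite mul0r add0r oner_eq0.
Qed.

(** * Regular sequences of length two *)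

Section Coprime.
Variable S : comNzRingType.
Implicit Types U V : S.

(** Multiplication by [U] is injective modulo [V]. With [V] regular this is the regular sequence
    condition on [V], [U], except that they may generate the unit ideal. *)
Definition quasi_coprime U V :=
  forall x y, U * x = V * y -> exists z, x = V * z.

Lemma quasi_coprimeMl U1 U2 V :
  quasi_coprime U1 V -> quasi_coprime U2 V -> quasi_coprime (U1 * U2) V.
Proof.
move=> cop1 cop2 x y; rewrite -mulrA => /cop1[z Vz]; exact: (cop2 x z).
Qed.

Lemma quasi_coprimeMr U V1 V2 : regular V1 ->
  quasi_coprime U V1 -> quasi_coprime U V2 -> quasi_coprime U (V1 * V2).
Proof.
move=> reg1 cop1 cop2 x y; rewrite -mulrA => eq_xy.
have [z xz] := cop1 _ _ eq_xy.
have [|w zw] := cop2 z y; last by exists w; rewrite xz zw mulrA.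
by apply: (regular_inj reg1); rewrite /= -eq_xy xz mulrCA.
Qed.

Lemma quasi_coprimeNl U V : quasi_coprime U V -> quasi_coprime (- U) V.
Proof.
by move=> cop x y Uxy; apply: (cop x (- y)); rewrite mulrN -Uxy; ring.
Qed.

Lemma quasi_coprimeNr U V : quasi_coprime U V -> quasi_coprime U (- V).
Proof.
move=> cop x y Uxy; have [|z ->] := cop x (- y); first by rewrite Uxy; ring.
by exists (- z); ring.
Qed.

Lemma quasi_coprime1l V : quasi_coprime 1 V.
Proof. by move=> x y; rewrite mul1r; exists y. Qed.

Lemma quasi_coprime1r U : quasi_coprime U 1.
Proof. by move=> x y _; exists x; rewrite mul1r. Qed.

Lemma quasi_coprime_prodl I (r : seq I) (P : pred I) (F : I -> S) V :
  (forall i, P i -> quasi_coprime (F i) V) ->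
  quasi_coprime (\prod_(i <- r | P i) F i) V.
Proof.
move=> copF; elim/big_ind: _ => //; first exact: quasi_coprime1l.
by move=> U1 U2; apply: quasi_coprimeMl.
Qed.

Lemma quasi_coprime_prodr I (r : seq I) (P : pred I) (F : I -> S) U :
    (forall i, P i -> regular (F i)) ->
    (forall i, P i -> quasi_coprime U (F i)) ->
  quasi_coprime U (\prod_(i <- r | P i) F i).
Proof.
move=> regF copF; suff [] : regular (\prod_(i <- r | P i) F i) /\
  quasi_coprime U (\prod_(i <- r | P i) F i) by [].
elim/big_ind: _ => [|V1 V2 [reg1 cop1] [reg2 cop2]|i Pi]; last first.
- by split; [apply: regF | apply: copF].
- by split; [apply: regularM | apply: quasi_coprimeMr].
- by split; [apply: regular1 | apply: quasi_coprime1r].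
Qed.

Lemma quasi_coprimeX U V m : regular V -> quasi_coprime U V ->
  quasi_coprime (U ^+ m) (V ^+ m).
Proof.
move=> regV copUV; rewrite -(subn0 m) -!prodr_const_nat.
apply: quasi_coprime_prodr => // _ _.
exact: quasi_coprime_prodl.
Qed.

End Coprime.

Section Reflections.
Variables (G : finGroupType) (L : zmodType) (act : lattice_action G L).

Lemma lactK g : cancel (act g) (act g^-1%g).
Proof. by move=> x; rewrite -lactM mulVg lact1. Qed.

Lemma lact_int_comb g n (b : 'I_n -> L) c :
  act g (int_comb b c) = int_comb (fun i => act g (b i)) c.
Proof.
by rewrite /int_comb raddf_sum; apply: eq_bigr => i _; rewrite raddfMz.
Qed.

(** The image of [x ^ g - 1] is the translate by [g^-1] of the image of [x - 1], and a basis is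
    translated along. *)
Lemma reflection_conj x g : reflection act x -> reflection act (x ^ g)%g.
Proof.
move=> [r le_r1 [b [inj_b span_b]]]; exists r => //.
exists (fun i => act g^-1%g (b i)); split=> [c c'|y].
  by rewrite -!lact_int_comb => /(can_inj (lactK _))/inj_b.
have [span_to span_from] := span_b (act g y); split=> [[l yE]|[c yE]].
  case: span_to => [|c yc].
    exists (act g l); rewrite yE raddfB /= -!lactM conjgE !mulgA mulgV.
    by rewrite mul1g.
  by exists c; rewrite -lact_int_comb -yc lactK.
case: span_from => [|l ly].
  by exists c; rewrite yE -lact_int_comb -lactM mulgV lact1.
exists (act g^-1%g l); rewrite -lactM conjgE -mulgA mulgK lactM -raddfB /= -ly.
by rewrite lactK.
Qed.

Definition disp g (l : L) : L := act g l - l.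
Lemma disp_zmod_morphism g : zmod_morphism (disp g).
Proof.
move=> x y; rewrite /disp raddfB /= !opprB [y - x]addrC addrACA.
by rewrite [- act g y + y]addrC.
Qed.
HB.instance Definition _ g := GRing.isZmodMorphism.Build L L (disp g)
  (disp_zmod_morphism g).

End Reflections.

(** Serves for maps between invariant rings, seen inside K[L], and, with [iR] the identity, for the
    inverse of a bijective morphism. *)
Lemma factor_morphism (R A S : comNzRingType) (iA : {rmorphism A -> S})
    (iR : {rmorphism R -> S}) (f : R -> A) :
    injective iA -> (forall r, iA (f r) = iR r) ->
  zmod_morphism f * monoid_morphism f.
Proof.
move=> iA_inj fE; split; last split.
- by move=> x y; apply: iA_inj; rewrite rmorphB /= !fE rmorphB.
- by apply: iA_inj; rewrite fE !rmorph1.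
- by move=> x y; apply: iA_inj; rewrite rmorphM /= !fE rmorphM.
Qed.

(** * Invariants of a normal subgroup *)

Section SubAction.
Variables (G : finGroupType) (L : zmodType) (act : lattice_action G L).
Variables (H : {group G}) (K : comNzRingType).
Local Notation S := (monoid_algebra K L).
Local Notation R := (invariant_ring act K).

Definition sub_lact (h : subg_of H) (x : L) : L := act (sgval h) x.

Lemma sub_lact1 x : sub_lact 1%g x = x.
Proof. by rewrite /sub_lact lact1. Qed.
Lemma sub_lactM (g h : subg_of H) x :
  sub_lact (g * h)%g x = sub_lact g (sub_lact h x).
Proof. by rewrite /sub_lact lactM. Qed.
Lemma sub_lactD (g : subg_of H) : {morph sub_lact g : x y / x + y}.
Proof. by move=> x y; rewrite /sub_lact lactD. Qed.

Definition sub_action : lattice_action (subg_of H) L :=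
  LatticeAction sub_lact1 sub_lactM sub_lactD.

Local Notation A := (invariant_ring sub_action K).

Definition conj_alg (g : G) : {rmorphism S -> S} := ma_map (act g).

Lemma conj_algE g (s : S) :
  conj_alg g s = \sum_(l <- msupp s) s@_l *: mono K (act g l).
Proof.
rewrite {1}[s]ma_expand /conj_alg /= linear_sum.
by apply: eq_bigr => l _; rewrite linearZ /= ma_mapU.
Qed.

Lemma conj_alg1 s : conj_alg 1%g s = s.
Proof.
rewrite conj_algE [RHS]ma_expand.
by apply: eq_bigr => l _; rewrite lact1.
Qed.

Lemma conj_alg_mono g l : conj_alg g (mono K l) = mono K (act g l).
Proof. by rewrite /conj_alg /= ma_mapU. Qed.

Lemma conj_algM g h s : conj_alg (g * h)%g s = conj_alg g (conj_alg h s).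
Proof.
rewrite !(conj_algE _ s) rmorph_sum; apply: eq_bigr => l _.
by rewrite /conj_alg /= linearZ /= ma_mapU lactM.
Qed.

Lemma sub_actionE h (hH : h \in H) s :
  ma_map (sub_action (subg H h)) s = conj_alg h s.
Proof.
by rewrite /= /ma_map; apply: eq_bigr => l _; rewrite /= /sub_lact subgK.
Qed.

Lemma invariantP s :
  reflect (forall g, conj_alg g s = s) (s \in Defs.invariant act (K := K)).
Proof. exact: 'forall_eqP. Qed.

Lemma sub_invariantP s : reflect (forall h, h \in H -> conj_alg h s = s)
  (s \in Defs.invariant sub_action (K := K)).
Proof.
apply: (iffP 'forall_eqP) => [inv h hH|inv h].
  by rewrite -(sub_actionE hH) inv.
by rewrite -{1}[h]sgvalK sub_actionE ?subgP // inv ?subgP.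
Qed.

Definition val_inv : {rmorphism R -> S} := val.
Definition val_sub : {rmorphism A -> S} := val.

Lemma val_inv_inj : injective val_inv. Proof. exact: val_inj. Qed.
Lemma val_sub_inj : injective val_sub. Proof. exact: val_inj. Qed.

Lemma val_fixed a h : h \in H -> conj_alg h (val_sub a) = val_sub a.
Proof. by move: h; apply/sub_invariantP; case: a. Qed.

Lemma val_sub_onto s : (forall h, h \in H -> conj_alg h s = s) ->
  exists a, val_sub a = s.
Proof. by move=> /sub_invariantP s_inv; exists (InvariantRing s_inv). Qed.

Fact restr_proof (r : R) : val r \in Defs.invariant sub_action (K := K).
Proof. by apply/sub_invariantP => h _; apply/invariantP; case: r. Qed.

Definition to_sub (r : R) : A := InvariantRing (restr_proof r).

Lemma to_subK r : val_sub (to_sub r) = val_inv r. Proof. by []. Qed.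

Let to_sub_morphism := factor_morphism val_sub_inj to_subK.
HB.instance Definition _ := GRing.isZmodMorphism.Build R A to_sub
  to_sub_morphism.1.
HB.instance Definition _ := GRing.isMonoidMorphism.Build R A to_sub
  to_sub_morphism.2.

Hypothesis nHG : forall g, g \in 'N(H)%g.

Fact conj_sub_proof g (a : A) :
  conj_alg g (val_sub a) \in Defs.invariant sub_action (K := K).
Proof.
apply/sub_invariantP => h hH; rewrite -conj_algM.
have -> : (h * g = g * (h ^ g))%g by rewrite conjgE mulKVg.
by rewrite conj_algM val_fixed // memJ_norm.
Qed.

Definition conj_sub g (a : A) : A := InvariantRing (conj_sub_proof g a).

Lemma conj_subE g a : val_sub (conj_sub g a) = conj_alg g (val_sub a).
Proof. by []. Qed.

Let conj_sub_morphism g := @factor_morphism A A S val_sub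
  (conj_alg g \o val_sub) _ val_sub_inj (conj_subE g).
HB.instance Definition _ g := GRing.isZmodMorphism.Build A A (conj_sub g)
  (conj_sub_morphism g).1.
HB.instance Definition _ g := GRing.isMonoidMorphism.Build A A (conj_sub g)
  (conj_sub_morphism g).2.

End SubAction.

Section ReflectionGroup.
Variables (G : finGroupType) (L : zmodType) (act : lattice_action G L).

(** Informative excluded middle turns the proposition [reflection] into a boolean, as membership in
    a finite set requires. *)
Definition reflections : {set G} :=
  [set g | if excluded_middle_informative (reflection act g) is left _
           then true else false].

Lemma reflectionsP g : reflect (reflection act g) (g \in reflections).
Proof. by rewrite inE; case: excluded_middle_informative => h; constructor. Qed.

Definition refl_group : {group G} := <<reflections>>%G.

Lemma refl_group_normal g : g \in 'N(refl_group)%g.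
Proof.
suff /norms_gen/subsetP/(_ g) : [set: G] \subset 'N(reflections)%g.
  by apply; rewrite inE.
apply/subsetP => x _; rewrite inE; apply/subsetP => _ /imsetP[y y_refl ->].
by apply/reflectionsP/reflection_conj/reflectionsP.
Qed.

Lemma notin_refl_group g : g \notin refl_group -> forall r, (r <= 1)%N ->
  ~ has_rank (fun x => exists l, x = disp act g l) r.
Proof.
move=> /negP g_H r le_r1 rank_r; apply/g_H/mem_gen/reflectionsP.
by exists r.
Qed.

End ReflectionGroup.

Section Augmentation.
Variables (G : finGroupType) (L : zmodType) (act : lattice_action G L).
Variable K : comNzRingType.
Local Notation S := (monoid_algebra K L).

Fact one_morph : {morph (fun _ : L => 1 : K) : x y / x + y >-> x * y}.
Proof. by move=> x y; rewrite mulr1. Qed.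

(** Evaluation at the identity of the torus Spec K[L], a point fixed by G. *)
Definition augmentation : {rmorphism S -> K} :=
  ma_lift (idfun : {rmorphism K -> K}) (erefl : (fun _ : L => 1 : K) 0 = 1)
    one_morph.

Lemma augmentationC a : augmentation a%:A = a.
Proof. by rewrite /augmentation /= ma_liftZ rmorph1 mulr1. Qed.

Lemma augmentation_conj g s :
  augmentation (conj_alg act K g s) = augmentation s.
Proof.
rewrite conj_algE rmorph_sum [in RHS](ma_expand s) [RHS]rmorph_sum.
by apply: eq_bigr => l _; rewrite /augmentation /= !ma_liftZ !ma_lift_mono.
Qed.

End Augmentation.

(** * Discriminants of generic monomials and conclusion *)

Section Main.
Variables (K : closedFieldType) (L : zmodType) (n : nat) (G : finGroupType).
Variables (act : lattice_action G L) (HL : lattice_of_rank L n).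
Local Notation S := (monoid_algebra K L).
Local Notation R := (invariant_ring act K).
Local Notation H := (refl_group act).
Local Notation sigma := (conj_alg act K).
Local Notation valA := (val_sub act H K).
Local Notation A := (invariant_ring (sub_action act H) K).

Let domS (s : S) : s != 0 -> regular s := @ma_regular K L n HL s.
Let sigma1 := @conj_alg1 G L act K.
Let sigmaM := @conj_algM G L act K.
Let jK : {rmorphism K -> S} := GRing.in_alg S.

Lemma fixK g c : sigma g (jK c) = jK c.
Proof. by rewrite /jK /= /conj_alg /= linearZ /= rmorph1. Qed.

Lemma generic_lattice_pair : exists l l', forall g g',
  g \notin H -> g' \notin H ->
  [/\ disp act g l != 0, disp act g' l' != 0 &
    exists2 lam : {additive L -> int},
      lam (disp act g' l') = 0 & lam (disp act g l) != 0].
Proof.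
have [b basis_b] := HL; pose I := {g | g \notin H}.
have [i|l [l' gen]] :=
  @generic_pair L n b basis_b I (fun i => disp act (val i)).
  exact/notin_refl_group/(valP i).
by exists l, l' => g g' gH g'H; apply: (gen (exist _ g gH) (exist _ g' g'H)).
Qed.

Lemma repr_notin (q : coset_of H) h : q != 1%g -> h \in H ->
  (repr q * h)%g \notin H.
Proof.
move=> nz_q hH; rewrite groupMr //; apply: contra nz_q => qH.
by rewrite -[q]coset_reprK coset_id.
Qed.

Lemma mono_sub_conj g l : disp act g l != 0 ->
  mono K l - sigma g (mono K l) != 0.
Proof.
rewrite conj_alg_mono !subr_eq0; apply: contraNneq => /malgP/(_ l).
rewrite !mcoeffU eqxx; case: eqP => // _ /eqP.
by rewrite oner_eq0.
Qed.

Section Pair.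
Variables l l' : L.
Hypothesis gen_ll' : forall g g', g \notin H -> g' \notin H ->
  [/\ disp act g l != 0, disp act g' l' != 0 &
    exists2 lam : {additive L -> int},
      lam (disp act g' l') = 0 & lam (disp act g l) != 0].

Let V := (discr_poly H sigma (mono K l')).[mono K l'].
Let U := (discr_poly H sigma (mono K l)).[mono K l].

Let UE : U = _ := discr_poly_self H sigma1 sigmaM (mono K l).
Let VE : V = _ := discr_poly_self H sigma1 sigmaM (mono K l').

Let regF (q : coset_of H) h : q != 1%g -> h \in H ->
  regular (mono K l' - sigma (repr q * h)%g (mono K l')).
Proof.
move=> nz_q hH; apply/domS/mono_sub_conj.
by have [] := gen_ll' (repr_notin nz_q hH) (repr_notin nz_q hH).
Qed.

Let regV : regular V.
Proof.
rewrite VE; apply: regular_bigprod => q nz_q.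
by apply/regularN/regular_bigprod => h hH; apply: regF.
Qed.

Lemma discr_pair_neq0 : V != 0.
Proof. exact: regular_neq0. Qed.

(** Up to sign, [U] and [V] are products of differences of two monomials, so single factors can be
    compared. The form [lam] is constant on the two exponents in the factor of [V] but not on those
    in the factor of [U], and [mono_dvd] applies. *)
Lemma discr_pair_coprime m : quasi_coprime (U ^+ m) (V ^+ m).
Proof.
apply: quasi_coprimeX; first exact: regV.
rewrite UE VE.
apply: quasi_coprime_prodr => q nz_q.
  by apply/regularN/regular_bigprod => h hH; apply: regF.
apply: quasi_coprimeNr; apply: quasi_coprime_prodr => h hH; first exact: regF.
apply: quasi_coprime_prodl => q' nz_q'; apply: quasi_coprimeNl.
apply: quasi_coprime_prodl => h' h'H x y.
rewrite !conj_alg_mono; have [_ _ [lam lam0 nz_lam]] :=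
  gen_ll' (repr_notin nz_q' h'H) (repr_notin nz_q hH).
apply: (mono_dvd (lam := lam)).
  apply/esym/eqP; rewrite -subr_eq0 -(raddfB lam).
  exact/eqP.
by rewrite eq_sym -subr_eq0 -(raddfB lam).
Qed.

(** If G fixes A, the norm polynomial [P] of [mono K l] and its conjugate by [g] agree on K, hence
    on all of S by interpolation. So [P] vanishes at [sigma g (mono K l)], which is impossible for
    [g] outside H, where [l] generic makes every factor regular. *)
Lemma sub_invariants_fixed :
    (forall g (a : A), sigma g (valA a) = valA a) ->
  H = [set: G] :> {set G}.
Proof.
move=> fixA; apply/setP => g; rewrite inE; apply: contraTT isT => g_H.
have : regular ((norm_poly H sigma (mono K l)).[sigma g (mono K l)]).
  rewrite /norm_poly horner_prod; apply: regular_bigprod => h hH.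
  rewrite hornerXsubC; apply: domS.
  have hgH : (h^-1 * g)%g \notin H by rewrite groupMl ?groupV.
  have [nz_disp _ _] := gen_ll' hgH hgH.
  have := mono_sub_conj nz_disp; apply: contraNneq => /eqP.
  rewrite subr_eq0 => /eqP eq_gh.
  by rewrite sigmaM eq_gh -sigmaM mulVg sigma1 subrr.
move/regular_neq0; case/negP; apply/eqP.
pose P := norm_poly H sigma (mono K l).
have [c|y] := @interpolation K S jK (@closed_field_infinite K) 0
    (P - map_poly (sigma g) P) _ (sigma g (mono K l)).
  have [a ac] := norm_elt sigmaM fixK (@val_sub_onto G L act H K) (mono K l) c.
  exists 0; rewrite mul0r hornerD hornerN -{2}(fixK g c) horner_map -ac fixA.
  by rewrite subrr.
by rewrite mul0r hornerD hornerN horner_map norm_poly_root // rmorph0 subr0.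
Qed.

End Pair.

Theorem reflection_generated (k : nat)
    (f : {lrmorphism R -> mixed_laurent K n k}) :
  bijective f -> H = [set: G] :> {set G}.
Proof.
move=> [f' fK f'K]; have [l [l' gen]] := generic_lattice_pair.
apply: (sub_invariants_fixed gen) => g a.
have f'_morph : zmod_morphism f' * monoid_morphism f'.
  exact: (@factor_morphism _ _ _ f idfun f' (can_inj fK) f'K).
pose f'A := GRing.isZmodMorphism.Build _ _ f' f'_morph.1.
pose f'M := GRing.isMonoidMorphism.Build _ _ f' f'_morph.2.
pose f'RM : {rmorphism mixed_laurent K n k -> R} := HB.pack f' f'A f'M.
pose inv : {rmorphism mixed_laurent K n k -> S} := val_inv act K \o f'RM.
(* The point of Spec R below the identity of the torus, in the mixed Laurent coordinates. *)
pose p : {rmorphism mixed_laurent K n k -> K} := augmentation L K \o inv.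
have pC c : p c%:A = c.
  rewrite /p /= /inv /=; have -> : f' c%:A = c%:A.
    by rewrite -[RHS]fK linearZ rmorph1.
  exact: augmentationC.
have sigma_inv g' r : sigma g' (val_inv act K r) = val_inv act K r.
  by move: g'; apply/invariantP; case: r.
have sepR (r : R) : r != 0 -> exists N (theta : {rmorphism R -> jet N S}),
    [/\ forall r, jcoef 0 (theta r) = valA (to_sub H r),
        forall g r, jet_map (sigma g) (theta r) = theta r
      & exists2 j, (j <= N)%N & augmentation L K (jcoef j (theta r)) != 0].
  (* A jet detecting [f r] at [p] is carried back to S by [inv]; its coefficients come from R, hence
     are fixed by G. *)
  move=> nz_r; have nz_fr : f r != 0.
    by rewrite -(rmorph0 f) (inj_eq (can_inj fK)).
  have [N [theta [theta0 [j le_jN nz_j]]]] :=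
    separating_jet (@closed_field_infinite K) pC nz_fr.
  exists N, (jet_map inv \o theta \o f); split=> [r'|g' r'|].
  - by rewrite /= jcoef_map // theta0 /= fK.
  - by apply: jetP => i le_iN; rewrite /= !jcoef_map // sigma_inv.
  by exists j; rewrite // /= jcoef_map.
pose alpha g' : {rmorphism A -> A} := conj_sub (@refl_group_normal G L act) g'.
pose iota : {rmorphism R -> A} := @to_sub G L act H K.
change (valA (alpha g a) = valA a); congr (valA _); move: g a.
apply: (conjugation_trivial (@refl_group_normal G L act) domS sigma1 sigmaM
  (@val_sub_inj G L act H K) (iota := iota) _ (@val_fixed G L act H K) _ _
  (@closed_field_infinite K) fixK (@val_sub_onto G L act H K)
  (s1 := mono K l) (s2 := mono K l') _ (discr_pair_neq0 gen)
  (alpha := alpha)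
  (eps := augmentation L K) _ (augmentation_conj act (K := K)) sepR).
- by move=> r r' eq_r; apply: val_inv_inj; exact: (congr1 valA eq_r).
- by move=> g' r; apply: sigma_inv.
- by move=> s /invariantP s_inv; exists (InvariantRing s_inv).
- by move=> m; apply: discr_pair_coprime.
by [].
Qed.

End Main.

Theorem theorem2p8 (K : closedFieldType) (L : zmodType) (n : nat)
    (G : finGroupType) (act : lattice_action G L)
    (HL : lattice_of_rank L n)
    (Hinv : exists2 k : nat, (k <= n)%N &
      exists f : {lrmorphism invariant_ring act K -> mixed_laurent K n k},
        bijective f) :
  exists2 S : {set G},
    forall g : G, g \in S -> reflection act g & <<S>>%g = [set: G].
Proof.
have [k _ [f bij_f]] := Hinv; exists (reflections act).
  by move=> g /reflectionsP.
exact: (reflection_generated HL bij_f).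
Qed.
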